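(* Let $B=(B_t;0\le t\le 1)$ be standard Brownian motion started at $0$. Then its Vervaat transform $(V(B)_t;\ 0 \leq t \leq 1)$ is not a Markov process with respect to its induced (natural) filtration.
   Context: Vervaat transform: for continuous $f:[0,1]\to\mathbb{R}$ with $f(0)=0$, let $\tau(f)$ be the first time at which $f$ attains its minimum on $[0,1]$. Define $V(f)(t)=f(\tau(f)+t)-f(\tau(f))$ for $0\le t\le 1-\tau(f)$ and $V(f)(t)=f(\tau(f)+t-1)+f(1)-f(\tau(f))$ for $1-\tau(f)\le t\le 1$. Markov is meant in the possibly time-inhomogeneous sense. *)

(* Defs.v *)
From mathcomp Require Import all_boot all_order all_algebra.
From mathcomp Require Import all_classical all_reals all_analysis.

Set Implicit Arguments.
Unset Strict Implicit.
Unset Printing Implicit Defensive.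

Import Order.TTheory GRing.Theory Num.Theory.
Import numFieldTopology.Exports numFieldNormedType.Exports.

Local Open Scope classical_set_scope.
Local Open Scope ring_scope.

(* Real functions on [0, 1] and processes indexed by [0, 1] are total functions
   of a real time t; their values at times outside [0, 1] are irrelevant. *)

(* The set of minimizers of a continuous f is closed and nonempty, so that the
   infimum is attained: it is the first time at which f attains its minimum. *)
Definition first_argmin (R : realType) (f : R -> R) : R :=
  inf [set t | t \in `[0, 1] /\ forall s, s \in `[0, 1] -> f t <= f s].

Definition vervaat (R : realType) (f : R -> R) (t : R) : R :=
  let tau := first_argmin f in
  if t <= 1 - tau then f (tau + t) - f tau
  else f (tau + t - 1) + f 1 - f tau.

(* The product rule for the whole family is enough: a subfamily is recovered by
   taking A i = setT at the other indices. *)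
Definition mutually_independent d (T : measurableType d) (R : realType)
    (P : probability T R) n (X : 'I_n -> T -> R) : Prop :=
  forall A : 'I_n -> set R, (forall i, measurable (A i)) ->
    P (\bigcap_(i in [set: 'I_n]) X i @^-1` A i) =
    (\prod_(i < n) P (X i @^-1` A i))%E.

(* The second parameter of normal_prob is the standard deviation. *)
Record standard_brownian_motion d (T : measurableType d) (R : realType)
    (P : probability T R) (B : R -> T -> R) : Prop := {
  sbm_measurable : forall t, t \in `[0, 1] -> measurable_fun setT (B t);
  sbm_start : forall w, B 0 w = 0;
  sbm_continuous : forall w, {within `[0, 1], continuous (B^~ w)};
  sbm_gaussian : forall s t, 0 <= s -> s < t -> t <= 1 ->
    forall A : set R, measurable A ->
      P ((fun w => B t w - B s w) @^-1` A) = normal_prob 0 (Num.sqrt (t - s)) A;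
  sbm_independent : forall n (t : nat -> R),
    0 <= t 0%N -> (forall i, (i < n)%N -> t i <= t i.+1) -> t n <= 1 ->
    mutually_independent P (fun (i : 'I_n) w => B (t i.+1) w - B (t i) w)
}.

Definition sigma_generated d (T : measurableType d) (R : realType)
    (X : R -> T -> R) (I : set R) : set (set T) :=
  <<s \bigcup_(u in I) preimage_set_system setT (X u) measurable >>.

Definition natural_filtration d (T : measurableType d) (R : realType)
    (X : R -> T -> R) (s : R) : set (set T) :=
  sigma_generated X `[0, s].

(* Y is a version of E[Z | G]. *)
Definition is_cond_exp d (T : measurableType d) (R : realType)
    (P : probability T R) (G : set (set T)) (Z Y : T -> R) : Prop :=
  [/\ forall A : set R, measurable A -> G (Y @^-1` A),
      P.-integrable setT (EFin \o Y) &
      forall C, G C ->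
        (\int[P]_(w in C) (Y w)%:E = \int[P]_(w in C) (Z w)%:E)%E].

(* For 0 <= s <= t <= 1 and Borel A,
     P(X_t \in A | X_u, u <= s) = P(X_t \in A | X_s)  almost surely,
   i.e. any versions of the two conditional probabilities agree almost
   surely. *)
Definition markov_process d (T : measurableType d) (R : realType)
    (P : probability T R) (X : R -> T -> R) : Prop :=
  forall s t, 0 <= s -> s <= t -> t <= 1 ->
  forall A : set R, measurable A ->
  forall Y Y' : T -> R,
    is_cond_exp P (natural_filtration X s) \1_(X t @^-1` A) Y ->
    is_cond_exp P (sigma_generated X [set s]) \1_(X t @^-1` A) Y' ->
    {ae P, forall w, Y w = Y' w}.

(* Main.v *)
From HB Require Import structures.
Require Import Defs.
From mathcomp Require Import all_boot all_order all_algebra.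
From mathcomp Require Import all_classical all_reals all_analysis.
From mathcomp Require Import measurable_realfun ring lra.

Set Implicit Arguments.
Unset Strict Implicit.
Unset Printing Implicit Defensive.

Import Order.TTheory GRing.Theory Num.Theory.
Import numFieldTopology.Exports numFieldNormedType.Exports.

Local Open Scope classical_set_scope.
Local Open Scope ring_scope.

(* Once the transform V is negative at time 1/4, its final value B_1 is
   negative too.  If V were Markov, the law of V_(1/2) on {V_(1/4) < 0} and its
   law on {V_1 > 0} would thus be mutually singular, carried by D and its
   complement.  By a qualitative Cameron-Martin theorem, adding to B a function
   that is affine between multiples of 1/8 preserves null events.  Two such
   families of shifts bring a Brownian path that stays in a tube [-M, M] into
   the first, respectively the second event, and translate V_(1/2) by a free
   parameter theta.  Picking two independent paths in the tube and letting each
   one's value of V_(1/2) determine the shift of the other, both reach the same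
   value of V_(1/2): by Fubini it almost surely belongs neither to D nor to its
   complement. *)

(** * Continuous paths and the transform *)

(** [D] is an arbitrary Borel set, and the null event produced by a shift depends on its parameter
    theta. Theta therefore cannot be read off the path being shifted. A second path supplies it: on
    each section of the product it is a constant, and the null statement for that constant applies.
    The shapes of the shifts are dictated by the rotation. If the argmin tau is late, the transform
    at 1/4 and 1/2 reads the path at tau - 3/4 and tau - 1/2; if it is early, the transform at 1/2
    reads it at tau + 1/2. Theta has to show at time 1/2 without moving tau or spoiling the sign
    required at 1/4 or 1. Confining tau to an interval of length 1/8 leaves room for this. Break
    points at multiples of 1/8 turn the stochastic integral in the Cameron-Martin density into a sum
    over eight increments. Its value is the same on every finer dyadic grid, which lets the shift
    formula pass from finitely many increments to whole paths. *)

Section path.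
Context {R : realType}.
Implicit Types (f g : R -> R) (x t : R) (n : nat).

(** Rounding down to a grid reduces statements about continuous paths to countably many times, and
    makes random times discrete. *)
Definition dyadic_floor n x : R := (Num.truncn (2 ^+ n * x))%:R / 2 ^+ n.

Lemma exp2_gt0 n : 0 < 2 ^+ n :> R. Proof. exact: exprn_gt0. Qed.

Lemma dyadic_floor_itv n x : 0 <= x ->
  dyadic_floor n x <= x < dyadic_floor n x + (2^-1) ^+ n.
Proof.
move=> x0; have h := exp2_gt0 n.
rewrite /dyadic_floor ler_pdivrMr// mulrC exprVn -[X in _ + X]mul1r -mulrDl.
by rewrite ltr_pdivlMr// [x * _]mulrC natr1 truncn_itv// mulr_ge0// ltW.
Qed.

Lemma dyadic_floor_ge0 n x : 0 <= dyadic_floor n x.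
Proof. by rewrite mulr_ge0// invr_ge0 ltW// exp2_gt0. Qed.

Lemma dyadic_floor01 n x : 0 <= x <= 1 -> 0 <= dyadic_floor n x <= 1.
Proof.
move=> /andP[x0 x1]; rewrite dyadic_floor_ge0/=; apply: le_trans x1.
by have /andP[] := dyadic_floor_itv n x0.
Qed.

Lemma cvg_dyadic_floor x : 0 <= x -> dyadic_floor n x @[n --> \oo] --> x.
Proof.
move=> x0; rewrite -[X in _ --> X]subr0.
have h : (x - (2^-1 : R) ^+ n) @[n --> \oo] --> x - 0.
  apply: cvgB; first exact: cvg_cst.
  by apply: cvg_expr; rewrite ger0_norm// invf_lt1// ltr1n.
have hx : (fun _ : nat => x) @ \oo --> x - 0 by rewrite subr0; exact: cvg_cst.
apply: (squeeze_cvgr _ h hx).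
apply: nearW => n; have /andP[-> /ltW] := dyadic_floor_itv n x0.
by rewrite andbT lerBlDr.
Qed.

Lemma path_cvg f (u : nat -> R) x : {within `[0, 1], continuous f} ->
  0 <= x <= 1 -> (forall n, 0 <= u n <= 1) -> u n @[n --> \oo] --> x ->
  f (u n) @[n --> \oo] --> f x.
Proof.
move=> /subspace_continuousP cf x01 u01 ux.
have /cf fx : [set` `[0, 1]] x by rewrite /= in_itv.
apply/cvgrPdist_lt => e e0; move/cvgrPdist_lt: fx => /(_ _ e0).
rewrite near_withinE => fx.
have h : \forall n \near \oo, [set` `[0, 1]] (u n) -> `|f x - f (u n)| < e.
  exact: (ux _ fx).
near=> n; have : [set` `[0, 1]] (u n) by rewrite /= in_itv/=.
by near: n.
Unshelve. all: by end_near. Qed.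

Lemma path_cvg_dyadic f x : {within `[0, 1], continuous f} -> 0 <= x <= 1 ->
  f (dyadic_floor n x) @[n --> \oo] --> f x.
Proof.
move=> cf x01; apply: path_cvg => // [n|]; first exact: dyadic_floor01.
by apply: cvg_dyadic_floor; case/andP: x01.
Qed.

Lemma path_bounded f : {within `[0, 1], continuous f} ->
  exists M, forall t, 0 <= t <= 1 -> `|f t| <= M.
Proof.
move=> cf; have [a _ ha] := EVT_min ler01 cf.
have [b _ hb] := EVT_max ler01 cf.
exists (Num.max `|f a| `|f b|) => t t01.
have := ha t; have := hb t; rewrite in_itv/= => /(_ t01) tb /(_ t01) ta.
rewrite ler_norml; apply/andP; split; last first.
  by rewrite le_max; apply/orP; right; exact: le_trans tb (ler_norm _).
rewrite lerNl le_max; apply/orP; left; rewrite -normrN.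
by apply: le_trans (ler_norm _); rewrite lerN2.
Qed.


Lemma first_argmin_spec f : {within `[0, 1], continuous f} ->
  [/\ 0 <= first_argmin f <= 1,
      forall s, 0 <= s <= 1 -> f (first_argmin f) <= f s &
      forall t, 0 <= t <= 1 -> (forall s, 0 <= s <= 1 -> f t <= f s) ->
        first_argmin f <= t].
Proof.
move=> cf; rewrite /first_argmin; set S := [set t | _].
have [c c01 hc] := EVT_min ler01 cf.
have Sc : S c by split.
have lbS : lbound S 0 by move=> x [] /=; rewrite in_itv/= => /andP[].
have infS : has_inf S by split; [exists c|exists 0].
have tau01 : 0 <= inf S <= 1.
  apply/andP; split; first by apply: lb_le_inf => //; exists c.
  apply: (@le_trans _ _ c); first by apply: ge_inf => //; exists 0.
  by move: c01; rewrite in_itv/= => /andP[].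
have adh n : {e | S e & e < inf S + (2^-1) ^+ n}.
  have h : 0 < (2^-1 : R) ^+ n by rewrite exprn_gt0// invr_gt0.
  exact: cid2 (inf_adherent h infS).
have ftau : f (inf S) = f c.
  pose u n := s2val (adh n).
  have uS n : S (u n) by exact: s2valP.
  have u01 n : 0 <= u n <= 1 by have [] := uS n; rewrite in_itv.
  have ux : u n @[n --> \oo] --> inf S.
    have h : (inf S + (2^-1 : R) ^+ n) @[n --> \oo] --> inf S + 0.
      apply: cvgD; first exact: cvg_cst.
      by apply: cvg_expr; rewrite ger0_norm// invf_lt1// ltr1n.
    have hx : (fun _ : nat => inf S) @ \oo --> inf S + 0 by rewrite addr0; exact: cvg_cst.
    rewrite -[X in _ --> X]addr0; apply: (squeeze_cvgr _ hx h).
    apply: nearW => n; rewrite ge_inf//; last by exists 0.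
    by apply: ltW; exact: (s2valP' (adh n)).
  have := path_cvg cf tau01 u01 ux.
  have -> : (fun n => f (u n)) = cst (f c).
    apply/funext => n /=; apply/eqP; rewrite eq_le hc; last by case: (uS n).
    by have [_ ->] := uS n.
  move=> /(@cvg_lim _ (@norm_hausdorff _ _)) <-.
  by rewrite lim_cst//; exact: norm_hausdorff.
split=> // [s s01|t t01 ht]; first by rewrite ftau hc// in_itv.
apply: ge_inf; first by exists 0.
by split=> [|s]; rewrite in_itv//=; exact: ht.
Qed.

(* With f 0 = 0 the two branches of the transform merge into one expression,
   which depends continuously on the argmin. *)
Definition rotate f tau t : R :=
  f (Num.min (tau + t) 1) + f (Num.max (tau + t - 1) 0) - f tau.

Lemma vervaatE f t : f 0 = 0 ->
  vervaat f t = rotate f (first_argmin f) t.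
Proof.
move=> f0; rewrite /vervaat /rotate; set tau := first_argmin f.
have [h|h] := leP t (1 - tau).
  rewrite min_l; last by lra.
  by rewrite max_r ?f0 ?addr0//; lra.
rewrite min_r; last by lra.
by rewrite max_l; lra.
Qed.

(** All minimizers of both functions lie in [A], where the functions differ by a constant and so
    rank times alike. This is how a change of theta will leave the argmin in place. *)
Lemma first_argmin_eq f g (A : set R) (a : R) :
  {within `[0, 1], continuous f} -> {within `[0, 1], continuous g} ->
  (forall t, 0 <= t <= 1 -> (forall s, 0 <= s <= 1 -> f t <= f s) -> A t) ->
  (forall t, 0 <= t <= 1 -> (forall s, 0 <= s <= 1 -> g t <= g s) -> A t) ->
  (forall t, A t -> g t = f t + a) ->
  first_argmin f = first_argmin g.
Proof.
move=> cf cg fA gA gf.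
have [f01 fmin ffirst] := first_argmin_spec cf.
have [g01 gmin gfirst] := first_argmin_spec cg.
have Af := fA _ f01 fmin; have Ag := gA _ g01 gmin.
apply/eqP; rewrite eq_le; apply/andP; split.
- apply: ffirst => // s s01; apply: le_trans (fmin _ s01).
  by have := gmin _ f01; rewrite (gf _ Af) (gf _ Ag) lerD2r.
- apply: gfirst => // s s01; apply: le_trans (gmin _ s01).
  by rewrite (gf _ Af) (gf _ Ag) lerD2r fmin.
Qed.

Lemma vervaat1 f : {within `[0, 1], continuous f} -> f 0 = 0 ->
  vervaat f 1 = f 1.
Proof.
move=> cf f0; rewrite vervaatE// /rotate.
have [/andP[t0 t1] _ _] := first_argmin_spec cf.
by rewrite min_r ?max_l; rewrite ?addrK ?addrAC ?subrr; lra.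
Qed.

(* Below level 0 the transform runs along the part of f preceding the argmin,
   shifted by f 1 - min f, hence stays above f 1. *)
Lemma vervaat_lt0 f t : {within `[0, 1], continuous f} -> f 0 = 0 ->
  0 <= t <= 1 -> vervaat f t < 0 -> f 1 < 0.
Proof.
move=> cf f0 t01; have [tau01 tmin _] := first_argmin_spec cf.
rewrite /vervaat; case: ifPn => h.
  rewrite subr_lt0 ltNge tmin//; move: tau01 => /andP[? ?]; lra.
have : f (first_argmin f) <= f (first_argmin f + t - 1).
  by apply: tmin; move: tau01 => /andP[? ?]; lra.
by lra.
Qed.

End path.

(** * Measurability of the transform *)

Section measurable_path.
Context d (T : measurableType d) (R : realType) (Z : R -> T -> R).
(** By continuity dyadic times determine the path. They are also the times directly accessible in
    the sigma-algebra generated by dyadic increments, to which these results are applied below. *)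
Hypothesis mZ : forall n i, (i <= 2 ^ n)%N ->
  measurable_fun setT (Z (i%:R / 2 ^+ n)).
Hypothesis cZ : forall w, {within `[0, 1], continuous (Z^~ w)}.

Lemma truncn_exp2_le n (x : R) : 0 <= x <= 1 ->
  (Num.truncn (2 ^+ n * x) <= 2 ^ n)%N.
Proof.
move=> /andP[x0 x1]; rewrite -(ler_nat R) natrX.
have h := @exp2_gt0 R n.
apply: (@le_trans _ _ (2 ^+ n * x)); first by rewrite truncn_le mulr_ge0// ltW.
by rewrite -[leRHS]mulr1 ler_pM2l.
Qed.

Lemma measurable_coord t : 0 <= t <= 1 -> measurable_fun setT (Z t).
Proof.
move=> t01; apply: (@measurable_fun_cvg _ _ _ _
    (fun n => Z (dyadic_floor n t))) => [n|w _].
  by apply: mZ; exact: truncn_exp2_le.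
exact: (path_cvg_dyadic (f := Z^~ w) (@cZ w) t01).
Qed.

(** The random time rounded down to a grid takes finitely many values, and on each of these pieces
    the path is read at a fixed time; then the grid is refined. *)
Lemma measurable_path_comp (sigma : T -> R) :
  measurable_fun setT sigma -> (forall w, 0 <= sigma w <= 1) ->
  measurable_fun setT (fun w => Z (sigma w) w).
Proof.
move=> ms s01; apply: (@measurable_fun_cvg _ _ _ _
    (fun n w => Z (dyadic_floor n (sigma w)) w)) => [n|w _]; last first.
  exact: (path_cvg_dyadic (f := Z^~ w) (@cZ w) (s01 w)).
move=> _ Y mY; rewrite setTI.
pose A k := if (k <= 2 ^ n)%N then
  sigma @^-1` `[k%:R / 2 ^+ n, k.+1%:R / 2 ^+ n[ `&` Z (k%:R / 2 ^+ n) @^-1` Y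
  else set0.
have Ae w k : Num.truncn (2 ^+ n * sigma w) = k <->
    k%:R / 2 ^+ n <= sigma w < k.+1%:R / 2 ^+ n.
  have h := @exp2_gt0 R n.
  have /andP[s0 _] := s01 w.
  rewrite ler_pdivrMr// ltr_pdivlMr// mulrC -truncn_eq ?mulr_ge0// ?ltW//.
  by split => [->|/eqP].
rewrite [X in measurable X](_ : _ = \bigcup_k A k).
  apply: bigcupT_measurable => k; rewrite /A; case: ifPn => // kn.
  apply: measurableI; rewrite -[X in measurable X]setTI.
    by apply: ms => //; exact: measurable_itv.
  exact: mZ.
apply/seteqP; split=> w /=.
  move=> Yw; exists (Num.truncn (2 ^+ n * sigma w)) => //.
  rewrite /A truncn_exp2_le//; split => //=.
  by rewrite in_itv/=; apply/Ae.
case=> k _; rewrite /A; case: ifPn => // kn [] /=.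
by rewrite in_itv/= => /Ae sk; rewrite /dyadic_floor sk.
Qed.

(** The cap at 1 keeps [q n i] in [0, 1] for every natural [i], so that countable unions and
    intersections can run over all indices. *)
Let q n i : R := Num.min (i%:R / 2 ^+ n) 1.

Let q01 n i : 0 <= q n i <= 1.
Proof.
rewrite /q ge_min lexx orbT andbT le_min ler01 andbT.
by rewrite mulr_ge0// invr_ge0 ltW// exp2_gt0.
Qed.

Let qE n x : 0 <= x <= 1 -> dyadic_floor n x = q n (Num.truncn (2 ^+ n * x)).
Proof.
by move=> x01; rewrite /q min_l//; have /andP[] := dyadic_floor01 n x01.
Qed.

(** The first argmin is at most [r] exactly when the minimum over [0, r] is already the minimum over
    [0, 1]. By continuity this can be tested, up to every error [2^-k], on countable dense sets of
    times; the times [r * q n i] are dense in [0, r] whatever [r] is. *)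
Let first_argmin_le r : 0 <= r <= 1 ->
  [set w | first_argmin (Z^~ w) <= r] =
  \bigcap_k \bigcup_n \bigcup_i \bigcap_m \bigcap_j
    [set w | Z (r * q n i) w <= Z (q m j) w + (2^-1) ^+ k].
Proof.
move=> /andP[r0 r1]; apply/seteqP; split=> w /=.
  move=> taur k _.
  have [tau01 taumin _] := first_argmin_spec (@cZ w).
  set tau := first_argmin _ in taur tau01 taumin.
  have [x x01 taux] : exists2 x, 0 <= x <= 1 & tau = r * x.
    have /andP[tau0 tau1] := tau01.
    have [r00|r00] := eqVneq r 0.
      by exists 0; rewrite ?lexx ?ler01// mulr0; apply/eqP; rewrite eq_le tau0 -r00 taur.
    have {}r0 : 0 < r by rewrite lt_def r00.
    exists (tau / r); last by rewrite mulrCA divff// mulr1.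
    by rewrite divr_ge0// ?(ltW r0)//= ler_pdivrMr// mul1r.
  have u01 n : 0 <= r * dyadic_floor n x <= 1.
    have /andP[? ?] := dyadic_floor01 n x01.
    by rewrite mulr_ge0//= mulr_ile1.
  have ux : r * dyadic_floor n x @[n --> \oo] --> tau.
    rewrite taux; apply: cvgMr.
    by apply: cvg_dyadic_floor; case/andP: x01.
  have := path_cvg (f := Z^~ w) (@cZ w) tau01 u01 ux.
  have h : 0 < (2^-1 : R) ^+ k by rewrite exprn_gt0// invr_gt0.
  move=> /cvgrPdist_lt/(_ _ h) [n _ /(_ n (leqnn _)) /= hn].
  exists n => //; exists (Num.truncn (2 ^+ n * x)) => // m _ j _ /=.
  rewrite -qE//; have := taumin _ (q01 m j).
  by move: hn; rewrite ltr_norml => /andP[]; lra.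
move=> H.
(* A minimizer over [0, r] is shown to be one over [0, 1], which bounds the first argmin by [c]. *)
have [c] : exists2 c, c \in `[0, r] & forall t, t \in `[0, r] -> Z c w <= Z t w.
  apply: EVT_min => //; apply: continuous_subspaceW (@cZ w).
  by move=> z /=; rewrite !in_itv/= => /andP[-> /le_trans ->].
rewrite in_itv/= => /andP[c0 cr] hc.
have [_ _ tauf] := first_argmin_spec (@cZ w).
apply: (le_trans _ cr); apply: tauf; first by rewrite c0 (le_trans cr).
move=> s s01.
have cs : Z (dyadic_floor k s) w + (2^-1) ^+ k @[k --> \oo] --> Z s w + 0.
  apply: cvgD; first exact: (path_cvg_dyadic (f := Z^~ w) (@cZ w) s01).
  by apply: cvg_expr; rewrite ger0_norm// invf_lt1// ltr1n.
rewrite addr0 in cs; rewrite -(cvg_lim (@norm_hausdorff _ _) cs)//.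
apply: limr_ge; first by apply/cvg_ex; eexists; exact: cs.
apply: nearW => k; have [n _ [i _ h]] := H k I.
have := h k I (Num.truncn (2 ^+ k * s)) I; rewrite /= -qE//.
apply: le_trans; apply: hc; have /andP[? ?] := q01 n i.
by rewrite in_itv/= mulr_ge0//= ler_piMr.
Qed.

Lemma measurable_first_argmin :
  measurable_fun setT (fun w => first_argmin (Z^~ w)).
Proof.
move=> mT; apply: (measurability _ (RGenOInfty.measurableE R)) => //.
move=> _ [_ [r ->] <-]; rewrite setTI.
rewrite [X in measurable X](_ : _ = ~` [set w | first_argmin (Z^~ w) <= r]).
  apply: measurableC.
  have [r0|r0] := ltP r 0.
    rewrite [X in measurable X](_ : _ = set0)// -subset0 => w /=.
    by have [/andP[]] := first_argmin_spec (@cZ w); lra.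
  have [r1|r1] := leP r 1; last first.
    rewrite [X in measurable X](_ : _ = setT)// -subTset => w _ /=.
    by have [/andP[]] := first_argmin_spec (@cZ w); lra.
  rewrite first_argmin_le ?r0//.
  apply: bigcapT_measurable => k; apply: bigcupT_measurable => n.
  apply: bigcupT_measurable => i; apply: bigcapT_measurable => m.
  apply: bigcapT_measurable => j; rewrite -[X in measurable X]setTI.
  have mA : measurable_fun setT (Z (r * q n i)).
    apply: measurable_coord; have /andP[? ?] := q01 n i.
    by rewrite mulr_ge0//= mulr_ile1.
  have mB : measurable_fun setT (fun w => Z (q m j) w + (2^-1) ^+ k).
    by apply: measurable_funD => //; exact: measurable_coord.
  have := measurable_fun_ler mA mB.
  by move=> /(_ measurableT [set true]); apply.
by apply/seteqP; split => w /=; rewrite in_itv/= andbT ltNge => /negP.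
Qed.

Lemma measurable_vervaat t : (forall w, Z 0 w = 0) -> 0 <= t <= 1 ->
  measurable_fun setT (fun w => vervaat (Z^~ w) t).
Proof.
move=> Z0 /andP[t0 t1]; under eq_fun do rewrite (vervaatE _ (Z0 _)).
have mtau := measurable_first_argmin.
have tau01 w : 0 <= first_argmin (Z^~ w) <= 1.
  by have [] := first_argmin_spec (@cZ w).
apply: measurable_funB; last exact: measurable_path_comp.
apply: measurable_funD.
- apply: (measurable_path_comp (sigma := fun w => Num.min _ _)).
    by apply: measurable_minr => //; exact: measurable_funD.
  move=> w; have /andP[? ?] := tau01 w.
  by rewrite ge_min lexx orbT andbT le_min ler01 andbT addr_ge0.
- apply: (measurable_path_comp (sigma := fun w => Num.max _ _)).
    apply: measurable_maxr => //; apply: measurable_funB => //.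
    exact: measurable_funD.
  move=> w; have /andP[? ?] := tau01 w.
  by rewrite le_max lexx orbT/= ge_max ler01 andbT; lra.
Qed.

End measurable_path.

(** * Conditional expectations and the Markov property *)

Section conditional_expectation.
Context d (T : measurableType d) (R : realType) (P : probability T R).
Variables (G : set (set T)) (A : set T).
Hypotheses (Gm : G `<=` measurable) (mA : measurable A).

Local Notation TG := (g_sigma_algebraType G).

Lemma g_sigma_measurable : <<s G >> `<=` measurable.
Proof. exact: smallest_sub (sigma_algebra_measurable T) Gm. Qed.

Let mid : measurable_fun setT (id : T -> TG).
Proof. by move=> _ C mC; rewrite setTI; exact: g_sigma_measurable. Qed.

(** The restriction of [P] to the smaller sigma-algebra is its image under the identity, viewed as a
    map onto [T] with that sigma-algebra. *)
Let idG : {mfun T >-> TG} := HB.pack (id : T -> TG)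
  (isMeasurableFun.Build _ _ _ _ _ mid).

Let nu (C : set TG) : \bar R := P (C `&` A).

Let nu0 : nu set0 = 0%E. Proof. by rewrite /nu set0I measure0. Qed.

Let nu_ge0 C : (0 <= nu C)%E. Proof. exact: measure_ge0. Qed.

Let nu_sigma_additive : semi_sigma_additive nu.
Proof.
move=> F mF tF mUF; rewrite /nu setI_bigcupl.
apply: measure_semi_sigma_additive.
- by move=> n; apply: measurableI => //; exact: (g_sigma_measurable (mF n)).
- apply/trivIsetP => i j _ _ ij; rewrite setIACA.
  by move/trivIsetP : tF => /(_ _ _ _ _ ij) ->//; rewrite set0I.
- rewrite -setI_bigcupl; apply: measurableI => //.
  exact: (g_sigma_measurable mUF).
Qed.

HB.instance Definition _ := isMeasure.Build _ _ _ nu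
  nu0 nu_ge0 nu_sigma_additive.

Let nu_fin : fin_num_fun nu.
Proof.
move=> C mC; apply: fin_num_measure; apply: measurableI => //.
exact: (g_sigma_measurable mC).
Qed.

HB.instance Definition _ := @Measure_isFinite.Build _ _ _ nu nu_fin.

Let nu_dominated : nu `<< distribution P idG.
Proof.
apply/null_content_dominatesP => C mC; rewrite -[X in X = _ -> _]/(P C) => PC0.
apply/eqP; rewrite eq_le measure_ge0 andbT -PC0.
have mC' := g_sigma_measurable mC.
by apply: le_measure; rewrite ?inE//; exact: measurableI.
Qed.

(** The version is the Radon-Nikodym derivative of [nu] with respect to the restriction of [P].
    Existence matters because [markov_process] compares given versions, and yields information only
    once some are at hand. *)
Lemma cond_exp_indic_exists : exists Y, is_cond_exp P <<s G >> \1_A Y.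
Proof.
pose f := Radon_Nikodym_SigmaFinite.f nu (distribution P idG).
have ffin x : f x \is a fin_num by exact: Radon_Nikodym_SigmaFinite.f_fin_num.
have f0 x : (0 <= f x)%E by exact: Radon_Nikodym_SigmaFinite.f_ge0.
have fint := Radon_Nikodym_SigmaFinite.f_integrable nu_dominated.
have mf : measurable_fun setT f by exact: measurable_int fint.
have fE C : <<s G >> C -> (\int[P]_(w in C) f w = P (C `&` A))%E.
  move=> GC; rewrite -[RHS]/(nu C).
  rewrite (Radon_Nikodym_SigmaFinite.f_integral nu_dominated)//.
  rewrite (ge0_integral_pushforward mid)//; last exact: measurable_funTS.
exists (fine \o f); have fK : EFin \o (fine \o f) = f.
  by apply/funext => x /=; rewrite fineK.
split.
- move=> B mB; have : measurable_fun setT (fine \o f).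
    by apply/measurable_EFinP; rewrite fK.
  by move=> /(_ measurableT _ mB); rewrite setTI.
- rewrite fK; apply/integrableP; split.
    move=> _ B mB; have := mf measurableT _ mB; rewrite !setTI.
    exact: g_sigma_measurable.
  under eq_integral => x _ do rewrite gee0_abs//.
  rewrite fE; last exact: (@measurableT _ TG).
  by rewrite ltey_eq fin_num_measure// setTI.
- move=> C GC; have mC := g_sigma_measurable GC.
  rewrite integral_indic// [A `&` C]setIC -[RHS](fE C GC).
  by apply: eq_integral => x _; rewrite fineK.
Qed.

End conditional_expectation.

Section markov.
Context d (T : measurableType d) (R : realType) (P : probability T R).
Variable X : R -> T -> R.

Lemma sigma_generated_measurable (I : set R) :
  (forall u, I u -> measurable_fun setT (X u)) ->
  \bigcup_(u in I) preimage_set_system setT (X u) measurable `<=` measurable.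
Proof. by move=> mX C [u Iu [D mD <-]]; exact: mX. Qed.

Lemma sigma_generated1 s C : sigma_generated X [set s] C ->
  exists2 D, measurable D & C = X s @^-1` D.
Proof.
rewrite /sigma_generated bigcup_set1 sigma_algebra_id.
  by move=> [D mD <-]; exists D; rewrite ?setTI.
exact/sigma_algebra_preimage/sigma_algebra_measurable.
Qed.

(* D is the zero set of the conditional probability of {X_t in A} given X_s:
   given the whole past this probability vanishes on C. *)
Lemma markov_mutually_singular s t (A : set R) (C : set T) :
  markov_process P X -> (forall u, 0 <= u <= 1 -> measurable_fun setT (X u)) ->
  0 <= s -> s <= t -> t <= 1 -> measurable A ->
  natural_filtration X s C -> P (C `&` X t @^-1` A) = 0%E ->
  exists D, [/\ measurable D, P (X s @^-1` D `&` X t @^-1` A) = 0%E &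
    P (C `&` X s @^-1` (~` D)) = 0%E].
Proof.
move=> markovX mX s0 st t1 mA FC PCA.
have t01 : 0 <= t <= 1 by rewrite t1 (le_trans s0 st).
have s01 : 0 <= s <= 1 by rewrite s0 (le_trans st t1).
have mXA u B : 0 <= u <= 1 -> measurable B -> measurable (X u @^-1` B).
  by move=> u01 mB; rewrite -[X in measurable X]setTI; exact: mX.
have mF : \bigcup_(u in `[0, s]) preimage_set_system setT (X u) measurable
    `<=` measurable.
  apply: sigma_generated_measurable => u /=; rewrite in_itv/= => /andP[u0 us].
  by apply: mX; rewrite u0 (le_trans us (le_trans st t1)).
have mS : \bigcup_(u in [set s]) preimage_set_system setT (X u) measurable
    `<=` measurable.
  by apply: sigma_generated_measurable => u ->; exact: mX.
have mC : measurable C by exact: (g_sigma_measurable mF).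
have [Y YF] := cond_exp_indic_exists P mF (mXA _ _ t01 mA).
have [Y' Y'S] := cond_exp_indic_exists P mS (mXA _ _ t01 mA).
have YY' := markovX s t s0 st t1 A mA Y Y' YF Y'S.
have [mY iY EY] := YF; have [mY' iY' EY'] := Y'S.
(* A version may be negative on a null set, hence the half-line in place of the point 0. Over this
   event the integral of [Y'] is nonpositive, and it equals the probability that the first claim
   needs to vanish. *)
have [D mD YD] : exists2 D, measurable D & Y' @^-1` `]-oo, 0] = X s @^-1` D.
  by apply: sigma_generated1; apply: mY'; exact: measurable_itv.
exists D; split => //.
  have mE : measurable (X s @^-1` D) by exact: mXA.
  apply/eqP; rewrite eq_le measure_ge0 andbT setIC.
  rewrite -integral_indic//; last exact: mXA.
  rewrite -EY' -?YD; last by apply: mY'; exact: measurable_itv.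
  rewrite -(integral0 P (Y' @^-1` `]-oo, 0])); apply: le_integral => //.
  - by rewrite YD.
  - by apply: integrableS iY' => //; rewrite YD.
  - exact: integrable0.
  - by move=> w; rewrite inE /= in_itv/= lee_fin.
have -> : C `&` X s @^-1` (~` D) = C `&` [set w | 0 < Y' w].
  rewrite -preimage_setC -YD; congr (_ `&` _); apply/seteqP; split => w /=;
  by rewrite in_itv/= ltNge => /negP.
(* The integral of the positive function [Y] over [F] is the probability of an event inside the null
   one of the hypothesis, so [F] is null. Since [Y] and [Y'] agree almost surely, the part of [C]
   where [Y'] is positive is contained in [F] up to a null set. *)
pose F := Y @^-1` `]0, +oo[ `&` C.
have FF : natural_filtration X s F.
  apply: (@measurableI _ (g_sigma_algebraType _)) => //.
  by apply: mY; exact: measurable_itv.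
have mFF : measurable F by exact: (g_sigma_measurable mF).
have PF : P F = 0%E.
  have : (\int[P]_(w in F) `|(Y w)%:E| = 0)%E.
    rewrite (_ : (\int[P]_(w in F) _)%E = \int[P]_(w in F) (Y w)%:E)%E; last first.
      apply: eq_integral => w; rewrite inE /F/= in_itv/= andbT => -[Yw _].
      by rewrite ger0_norm// ltW.
    rewrite EY// integral_indic//; last exact: mXA.
    apply/eqP; rewrite eq_le measure_ge0 andbT -PCA.
    apply: le_measure; rewrite ?inE; [apply: measurableI => //; exact: mXA..|].
    by move=> w [? [? ?]]; split.
  have mYF : measurable_fun F (EFin \o Y).
    by apply: measurable_funTS; exact: measurable_int iY.
  move/(ae_eq_integral_abs _ mFF mYF) => ae0; apply: measure_negligible => //.
  apply: negligibleS ae0 => w /= Fw; apply/existsNP; exists Fw => -[] Yw0.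
  by move: Fw; rewrite /F/= in_itv/= Yw0 ltxx => -[].
have m0 : measurable [set w | 0 < Y' w].
  rewrite (_ : [set _ | _] = Y' @^-1` `]0, +oo[).
    by apply: (g_sigma_measurable mS); apply: mY'; exact: measurable_itv.
  by apply/seteqP; split => w /=; rewrite in_itv/= andbT.
apply: measure_negligible; first exact: measurableI.
have nF : P.-negligible F by exact/negligibleP.
apply: negligibleS (negligibleU nF YY') => w /= [Cw Y'w].
have [YY'w|] := pselect (Y w = Y' w); last by right.
by left; split => //=; rewrite in_itv/= andbT YY'w.
Qed.

End markov.

(** * Densities and products of independent variables *)

Section density.
Context d (T : measurableType d) (R : realType).
Variables (mu : {measure set T -> \bar R}) (h : T -> R).
Hypotheses (mh : measurable_fun setT h) (h0 : forall x, 0 <= h x).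

Definition density (A : set T) : \bar R := (\int[mu]_(x in A) (h x)%:E)%E.

Let density0 : density set0 = 0%E.
Proof. exact: integral_set0. Qed.

Let density_ge0 A : (0 <= density A)%E.
Proof. by apply: integral_ge0 => x _; rewrite lee_fin. Qed.

Let density_sigma_additive : semi_sigma_additive density.
Proof.
move=> F mF tF mUF; rewrite /density ge0_integral_bigcup//.
- by apply: is_cvg_ereal_nneg_natsum_cond => n _ _; exact: density_ge0.
- by apply/measurable_EFinP; exact: measurable_funTS.
- by move=> x _; rewrite lee_fin.
Qed.

HB.instance Definition _ := isMeasure.Build _ _ _ density
  density0 density_ge0 density_sigma_additive.

Import HBNNSimple.

Lemma ge0_integral_density (g : T -> \bar R) :
  measurable_fun setT g -> (forall x, 0 <= g x)%E ->
  (\int[density]_x g x = \int[mu]_x (g x * (h x)%:E))%E.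
Proof.
move=> mg g0; pose f_ := nnsfun_approx measurableT mg.
have f_g x : ((f_ n x)%:E @[n --> \oo] --> g x)%E by exact: cvg_nnsfun_approx.
have f_nd x : {homo (fun n => f_ n x) : m n / (m <= n)%N >-> m <= n}.
  by move=> m n mn; exact/lefP/nd_nnsfun_approx.
have mEh : measurable_fun setT (EFin \o h) by exact/measurable_EFinP.
transitivity (limn (fun n => \int[density]_x (f_ n x)%:E))%E.
  rewrite -monotone_convergence//.
  - by apply: eq_integral => x _; apply/esym/cvg_lim.
  - by move=> n; exact/measurable_EFinP/measurable_funP.
  - by move=> n x _; rewrite lee_fin.
  - by move=> x _ m n mn; rewrite lee_fin; exact: f_nd.
transitivity (limn (fun n => \int[mu]_x ((f_ n x)%:E * (h x)%:E)))%E; last first.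
  rewrite -monotone_convergence//.
  - apply: eq_integral => x _; apply/cvg_lim => //.
    exact: cvgeZr.
  - move=> n; apply: emeasurable_funM => //.
    exact/measurable_EFinP/measurable_funP.
  - by move=> n x _; rewrite mule_ge0// lee_fin.
  - by move=> x _ m n mn; rewrite lee_wpmul2r ?lee_fin//; exact: f_nd.
congr (limn _); apply/funext => n.
rewrite integralT_nnsfun sintegralE.
transitivity (\int[mu]_x (\sum_(r \in range (f_ n))
    (r * \1_(f_ n @^-1` [set r]) x)%:E * (h x)%:E))%E; last first.
  apply: eq_integral => x _; rewrite fimfunE -fsumEFin//.
  by rewrite ge0_mule_fsuml// => r; rewrite nnfun_muleindic_ge0.
have mfr r : measurable (f_ n @^-1` [set r]) by exact: measurable_sfunP.
rewrite ge0_integral_fsum//; last 2 first.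
- move=> r; apply: emeasurable_funM => //.
  by apply/measurable_EFinP/measurable_funM.
- by move=> r x _; rewrite mule_ge0 ?nnfun_muleindic_ge0 ?lee_fin.
apply: eq_fsbigr => r; rewrite inE => -[x _ <-{r}].
under eq_integral do rewrite EFinM -muleA.
rewrite ge0_integralZl//; last 3 first.
- by apply: emeasurable_funM => //; apply/measurable_EFinP/measurable_indic.
- by move=> y _; rewrite mule_ge0 ?lee_fin.
- by rewrite lee_fin.
congr (_ * _)%E; rewrite [LHS]integral_mkcond.
apply: eq_integral => y _; rewrite patchE indicE.
by case: ifPn => _; rewrite ?mul1e ?mul0e.
Qed.

End density.

(** The exponential is the ratio of the normal density at [x - l] to that at [x]: weighting by it
    translates the law by [l]. *)
Lemma normal_shift d (T : measurableType d) (R : realType)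
    (P : probability T R) (D : T -> R) (sigma l : R) (A : set R) :
  0 < sigma -> measurable_fun setT D -> measurable A ->
  (forall C, measurable C -> P (D @^-1` C) = normal_prob 0 sigma C) ->
  (\int[P]_w (\1_A (D w) * expR ((l * D w - l ^+ 2 / 2) / sigma ^+ 2))%:E =
   P [set w | A (D w + l)%R])%E.
Proof.
move=> s0 mD mA lawD; have sn0 : sigma != 0 by rewrite gt_eqF.
pose S := measurableTypeR R.
pose e (x : S) : R := expR ((l * x - l ^+ 2 / 2) / sigma ^+ 2).
have e0 x : 0 <= e x by exact: expR_ge0.
have me : measurable_fun setT e.
  apply: measurableT_comp => //; apply: (@measurable_funM _ R) => //.
  by apply: measurable_funB => //; exact: measurable_funM.
have mAe : measurable_fun (setT : set S) (fun x => (\1_A x * e x)%:E).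
  by apply/measurable_EFinP/measurable_funM => //; exact: measurable_indic.
have Ae0 x : (0 <= (\1_A x * e x)%:E)%E by rewrite lee_fin mulr_ge0.
have pdf0 (x : S) : 0 <= normal_pdf 0 sigma x by exact: normal_pdf_ge0.
have mpdf : measurable_fun (setT : set S) (normal_pdf 0 sigma).
  exact: measurable_normal_pdf.
have mD' : measurable_fun setT (D : T -> S) by exact: mD.
transitivity (\int[pushforward P (D : T -> S)]_x (\1_A x * e x)%:E)%E.
  by rewrite (ge0_integral_pushforward mD').
transitivity (\int[density (@lebesgue_measure R) (normal_pdf 0 sigma)]_x
    (\1_A x * e x)%:E)%E.
  by apply: eq_measure_integral => C mC _; exact: lawD.
rewrite ge0_integral_density//.
have mshift : measurable_fun setT ((fun x => x + l) : S -> S).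
  exact: (@measurable_funD _ R).
have -> : P [set w | A (D w + l)] = normal_prob 0 sigma ((fun x => x + l) @^-1` A).
  by rewrite -lawD// -[X in measurable X]setTI; exact: mshift.
pose F (x : S) := (normal_pdf 0 sigma (x - l))%:E.
have mF : measurable_fun setT F.
  apply/measurable_EFinP; apply: measurableT_comp => //.
  exact: (@measurable_funB _ R).
transitivity (\int[lebesgue_measure]_(x in A) F x)%E.
  rewrite [RHS]integral_mkcond; apply: eq_integral => x _.
  rewrite patchE indicE; case: ifPn => _; last by rewrite !mul0r mul0e.
  rewrite /F !normal_pdfE// mul1r -EFinM mulrCA /normal_fun -expRD !subr0.
  congr ((_ * expR _)%R%:E); field.
  by rewrite sn0.
transitivity (\int[pushforward lebesgue_measure (+%R^~ l : S -> S)]_(x in A) F x)%E.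
  (* Translation invariance of Lebesgue measure, by uniqueness from half-open intervals. *)
  apply: eq_measure_integral => C mC _.
  apply: lebesgue_measure_unique => //= _ [[a b]] _ <-.
  rewrite /pushforward.
  rewrite (_ : _ @^-1` _ = `]a - l, b - l]%classic); last first.
    by apply/seteqP; split => x /=; rewrite !in_itv/= ltrBlDr lerBrDr.
  rewrite !lebesgue_measure_itv/= !lte_fin ltrD2r; case: ifP => // _.
  by congr (_%:E); ring.
rewrite ge0_integral_pushforward//.
- by apply: eq_integral => x _; rewrite /F/= addrK.
- exact: measurable_funTS.
- by move=> x _; rewrite lee_fin.
Qed.

(** Indicators are replaced by general functions one index at a time, those of index at least [k]
    still being indicators. When the factors other than [i0] are taken as a density, the induction
    hypothesis says that the law of [X i0] becomes a constant multiple of its law under [P];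
    integrating [g i0] against both gives the step. *)
Lemma expectation_prod d (T : measurableType d) (R : realType)
    (P : probability T R) n (X : 'I_n -> T -> R) (g : 'I_n -> R -> R) :
  (forall i, measurable_fun setT (X i)) -> mutually_independent P X ->
  (forall i, measurable_fun setT (g i)) -> (forall i x, 0 <= g i x) ->
  (forall i, \int[P]_w (g i (X i w))%:E < +oo)%E ->
  (\int[P]_w (\prod_(i < n) g i (X i w))%:E =
   \prod_(i < n) \int[P]_w (g i (X i w))%:E)%E.
Proof.
move=> mX indX.
suff H k : (k <= n)%N -> forall g : 'I_n -> R -> R,
    (forall i : 'I_n, (k <= i)%N -> exists2 A, measurable A & g i = \1_A) ->
    (forall i, measurable_fun setT (g i)) -> (forall i x, 0 <= g i x) ->
    (forall i, \int[P]_w (g i (X i w))%:E < +oo)%E ->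
    (\int[P]_w (\prod_(i < n) g i (X i w))%:E =
     \prod_(i < n) \int[P]_w (g i (X i w))%:E)%E.
  move=> mg g0 goo; apply: (H n) => // i; by rewrite leqNgt ltn_ord.
elim: k => [_|k IH kn] {}g gA mg g0 goo.
  pose A i := s2val (cid2 (gA i (leq0n _))).
  have mA i : measurable (A i) by exact: (s2valP (cid2 (gA i _))).
  have gAE i : g i = \1_(A i) by exact: (s2valP' (cid2 (gA i _))).
  have mXA i : measurable (X i @^-1` A i).
    by rewrite -[X in measurable X]setTI; exact: mX.
  transitivity (\int[P]_w (\1_(\bigcap_(i in [set: 'I_n]) X i @^-1` A i) w)%:E)%E.
    apply: eq_integral => w _; congr (_%:E); rewrite indicE.
    have [/set_mem h|/negP h] := boolP (w \in _).
      rewrite big1// => i _; rewrite gAE indicE mem_set//; exact: h.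
    have [i hi] : exists i, ~ A i (X i w).
      by apply/existsNP => h'; apply: h; rewrite inE => i _; exact: h'.
    by rewrite (bigD1 i)//= gAE indicE memNset ?mul0r.
  rewrite integral_indic//; last first.
    by apply: fin_bigcap_measurable => //; exact: finite_finset.
  rewrite setIT; apply: (etrans (indX _ mA)); apply: eq_bigr => i _; rewrite gAE.
  under eq_integral do rewrite -[\1_(A i) _]/(\1_(X i @^-1` A i) _).
  by rewrite integral_indic// setIT.
pose i0 := Ordinal kn.
pose H w := \prod_(i < n | i != i0) g i (X i w).
have mH : measurable_fun setT H.
  rewrite /H; under eq_fun do rewrite -big_filter.
  by apply: measurable_prod => i _; exact: measurableT_comp (mg i) (mX i).
have H0 w : 0 <= H w by apply: prodr_ge0.
pose e i := (\int[P]_w (g i (X i w))%:E)%E.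
have e0 i : (0 <= e i)%E by apply: integral_ge0 => w _; rewrite lee_fin.
have efin i : e i \is a fin_num by rewrite ge0_fin_numE// goo.
have c0 : 0 <= \prod_(i < n | i != i0) fine (e i).
  by apply: prodr_ge0 => i _; exact: fine_ge0.
pose c := NngNum c0.
have cE : (\prod_(i < n | i != i0) e i = c%:num%:E)%E.
  rewrite /= -prodEFin; apply: eq_bigr => i _; by rewrite fineK.
have HE A : measurable A ->
    (\int[P]_(w in X i0 @^-1` A) (H w)%:E = c%:num%:E * P (X i0 @^-1` A))%E.
  move=> mA.
  have mXA : measurable (X i0 @^-1` A).
    by rewrite -[X in measurable X]setTI; exact: mX.
  pose g' i := if i == i0 then \1_A else g i.
  have g'E w : g' i0 (X i0 w) = \1_(X i0 @^-1` A) w by rewrite /g' eqxx.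
  have e'i0 : (\int[P]_w (g' i0 (X i0 w))%:E = P (X i0 @^-1` A))%E.
    by under eq_integral do rewrite g'E; rewrite integral_indic// setIT.
  have e'E i : i != i0 -> g' i = g i by rewrite /g' => /negbTE ->.
  have g'H w : \prod_(i < n) g' i (X i w) = \1_(X i0 @^-1` A) w * H w.
    by rewrite (bigD1 i0)//= g'E; congr (_ * _); apply: eq_bigr => i /e'E ->.
  have e'H : (\prod_(i < n) \int[P]_w (g' i (X i w))%:E =
      c%:num%:E * P (X i0 @^-1` A))%E.
    rewrite (bigD1 i0)//= e'i0 muleC -cE; congr (_ * _)%E.
    by apply: eq_bigr => i /e'E ->.
  rewrite -e'H -(IH (ltnW kn) g').
  - rewrite integral_mkcond; apply: eq_integral => w _.
    by rewrite patchE g'H indicE; case: ifPn => _; rewrite ?mul1r ?mul0r.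
  - move=> i; have [->|ii0] := eqVneq i i0.
      by move=> _; exists A => //; rewrite /g' eqxx.
    rewrite (e'E _ ii0) leq_eqVlt => /orP[/eqP ki|]; last exact: gA.
    by move: ii0; rewrite -val_eqE /= -ki eqxx.
  - by move=> i; rewrite /g'; case: ifPn => // _; exact: measurable_indic.
  - by move=> i x; rewrite /g'; case: ifPn => // _; rewrite indicE.
  - move=> i; have [->|ii0] := eqVneq i i0; last by rewrite (e'E _ ii0).
    by rewrite e'i0 ltey_eq fin_num_measure.
have mgi : measurable_fun setT (EFin \o g i0) by exact/measurable_EFinP.
rewrite (bigD1 i0)//= -/(e i0) cE muleC.
transitivity (\int[P]_w ((g i0 (X i0 w))%:E * (H w)%:E))%E.
  by apply: eq_integral => w _; rewrite (bigD1 i0).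
rewrite -(ge0_integral_density P mH H0 (g := fun w => (g i0 (X i0 w))%:E)); last 2 first.
- exact: measurableT_comp mgi (mX i0).
- by move=> w; rewrite lee_fin.
transitivity (\int[pushforward (density P H) (X i0)]_x (g i0 x)%:E)%E.
  by rewrite (ge0_integral_pushforward (mX i0))//; move=> x _; rewrite lee_fin.
pose Xi : {mfun T >-> R} := HB.pack (X i0)
  (isMeasurableFun.Build _ _ _ _ _ (mX i0)).
transitivity (\int[mscale c (distribution P Xi)]_x (g i0 x)%:E)%E.
  by apply: eq_measure_integral => A mA _; exact: HE.
rewrite ge0_integral_mscale//; last by move=> x _; rewrite lee_fin.
by rewrite (ge0_integral_pushforward (mX i0))//; move=> x _; rewrite lee_fin.
Qed.
Lemma image_measure d d' (T1 : measurableType d) (T2 : measurableType d')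
    (R : realType) (m : {measure set T1 -> \bar R}) (f : T1 -> T2) :
  measurable_fun setT f ->
  exists m' : {measure set T2 -> \bar R}, forall A, m' A = m (f @^-1` A).
Proof. by move=> mf; unshelve eexists (pushforward m f). Qed.

(** * Cameron-Martin shifts along the dyadic grid *)

Lemma big_double (V : nmodType) m (F : nat -> V) :
  \sum_(j < m.*2) F j = \sum_(i < m) (F i.*2 + F i.*2.+1).
Proof.
elim: m => [|m IH]; first by rewrite !big_ord0.
by rewrite doubleS !big_ord_recr/= IH addrA.
Qed.

Section dyadic.
Context {R : realType}.

Definition tick n i : R := i%:R / 2 ^+ n.

Lemma tick_double n i : tick n.+1 i.*2 = tick n i.
Proof.
by rewrite /tick -muln2 natrM exprSr -mulf_div divff// mulr1.
Qed.

Lemma tick_shift n k i : tick (n + k) (i * 2 ^ k) = tick n i.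
Proof.
by rewrite /tick natrM natrX exprD -mulf_div divff ?mulr1.
Qed.

Lemma tick_le n i j : (i <= j)%N -> tick n i <= tick n j.
Proof. by move=> ij; rewrite ler_pM2r ?ler_nat// invr_gt0 exp2_gt0. Qed.

Lemma tick_ge0 n i : 0 <= tick n i.
Proof. by rewrite mulr_ge0// invr_ge0 ltW// exp2_gt0. Qed.

Lemma tick_le1 n i : (i <= 2 ^ n)%N -> tick n i <= 1.
Proof. by rewrite ler_pdivrMr ?exp2_gt0// mul1r -natrX ler_nat. Qed.

Lemma tickB n i : tick n i.+1 - tick n i = (2 ^+ n)^-1.
Proof. by rewrite /tick -mulrBl -natr1 addrAC subrr add0r mul1r. Qed.

End dyadic.

(* Affine on every dyadic cell of level at least 3, as far as midpoints can
   tell. *)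
Definition dyadic_affine (R : realType) (f : R -> R) := forall n i,
  (3 <= n)%N -> (i < 2 ^ n)%N ->
  f (tick n.+1 i.*2.+1) *+ 2 = f (tick n i) + f (tick n i.+1).

Section cameron_martin.
Context d (T : measurableType d) (R : realType) (P : probability T R).
Variables (B : R -> T -> R) (f : R -> R).
Hypothesis hB : standard_brownian_motion P B.
Hypotheses (f0 : f 0 = 0) (cf : {within `[0, 1], continuous f}).
Hypothesis af : dyadic_affine f.

Let mB t : 0 <= t <= 1 -> measurable_fun setT (B t).
Proof. by move=> t01; apply: (sbm_measurable hB); rewrite in_itv. Qed.

Let incr n i w := B (tick n i.+1) w - B (tick n i) w.
Let drift n i := f (tick n i.+1) - f (tick n i).
(** The Cameron-Martin exponent, the integral of f' against B minus half the integral of f'^2, for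
    the interpolation of [f] on the grid of level [n]. *)
Let logrho n w :=
  \sum_(i < 2 ^ n) (drift n i * incr n i w - drift n i ^+ 2 / 2) / (2 ^+ n)^-1.

Let mincr n i : (i < 2 ^ n)%N -> measurable_fun setT (incr n i).
Proof.
move=> ni; apply: measurable_funB; apply: mB; rewrite tick_ge0 tick_le1//.
exact: ltnW.
Qed.

(** Each half of a cell carries half of its drift, and the two increments of [B] add up: one density
    serves all levels from 3 on. *)
Let logrhoS n w : (3 <= n)%N -> logrho n.+1 w = logrho n w.
Proof.
move=> n3; pose F j := (drift n.+1 j * incr n.+1 j w - drift n.+1 j ^+ 2 / 2) /
  (2 ^+ n.+1)^-1.
rewrite /logrho expnS mul2n (big_double _ F); apply: eq_bigr => i _.
have := af n3 (ltn_ord i); rewrite /F /drift /incr -!doubleS !tick_double.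
rewrite mulr2n => h; have {h} -> : f (tick n.+1 i.*2.+1) =
    (f (tick n i) + f (tick n i.+1)) / 2 by lra.
rewrite !invrK [2 ^+ n.+1]exprS; set p := 2 ^+ n.
by field.
Qed.

Let rho w := expR (logrho 3 w).

Let rhoE n w : (3 <= n)%N -> rho w =
  \prod_(i < 2 ^ n)
    expR ((drift n i * incr n i w - drift n i ^+ 2 / 2) / (2 ^+ n)^-1).
Proof.
move=> n3; rewrite -expR_sum -/(logrho n w) /rho; congr expR.
rewrite -(subnK n3); elim: (n - 3)%N => [//|k ->].
by rewrite addSn logrhoS// leq_addl.
Qed.

Let mrho : measurable_fun setT rho.
Proof.
apply: measurableT_comp => //; apply: measurable_sum => i.
apply: measurable_funM => //; apply: measurable_funB => //.
by apply: measurable_funM => //; exact: mincr.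
Qed.

Let rho_ge0 w : 0 <= rho w. Proof. exact: expR_ge0. Qed.

Let incr_normal n i (A : set R) : (i < 2 ^ n)%N -> measurable A ->
  P (incr n i @^-1` A) = normal_prob 0 (Num.sqrt (2 ^+ n)^-1) A.
Proof.
move=> ni mA; rewrite -(tickB n i); apply: (sbm_gaussian hB) => //.
- exact: tick_ge0.
- by rewrite -subr_gt0 tickB invr_gt0 exp2_gt0.
- exact: tick_le1.
Qed.

Let incr_independent n :
  mutually_independent P (fun i : 'I_(2 ^ n) => incr n i).
Proof.
apply: (sbm_independent hB) => [|i _|].
- exact: tick_ge0.
- exact: tick_le.
- exact: tick_le1.
Qed.

(** At a fixed level the density is a product over independent increments, so the formula splits
    into one-dimensional Gaussian shifts. *)
Let density_cylinder n (A : nat -> set R) : (3 <= n)%N ->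
  (forall i, measurable (A i)) ->
  density P rho [set w | forall i, (i < 2 ^ n)%N -> A i (incr n i w)] =
  P [set w | forall i, (i < 2 ^ n)%N -> A i (incr n i w + drift n i)].
Proof.
move=> n3 mA.
have s0 : 0 < Num.sqrt ((2 ^+ n)^-1 : R) by rewrite sqrtr_gt0 invr_gt0 exp2_gt0.
have s2 : Num.sqrt ((2 ^+ n)^-1 : R) ^+ 2 = (2 ^+ n)^-1.
  by rewrite sqr_sqrtr// invr_ge0 ltW// exp2_gt0.
have shift (i : 'I_(2 ^ n)) :=
  normal_shift (drift n i) s0 (mincr (ltn_ord i)) (mA i)
    (fun C => @incr_normal n i C (ltn_ord i)).
rewrite s2 in shift.
pose g (i : 'I_(2 ^ n)) (x : R) : R := \1_(A i) x *
  expR ((drift n i * x - drift n i ^+ 2 / 2) / (2 ^+ n)^-1).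
pose A' (i : 'I_(2 ^ n)) := [set x | A i (x + drift n i)].
have mA' i : measurable (A' i).
  rewrite -[X in measurable X]setTI.
  have : measurable_fun setT (fun x : R => x + drift n i).
    exact: measurable_funD.
  by apply.
transitivity (\int[P]_w (\prod_(i < 2 ^ n) g i (incr n i w))%:E)%E.
  rewrite /density integral_mkcond; apply: eq_integral => w _.
  rewrite patchE (rhoE _ n3) big_split/=; case: ifPn => [/set_mem h|/negP h].
    rewrite [X in _ = (X * _)%:E]big1 ?mul1r// => i _.
    by rewrite indicE mem_set//; exact: h.
  have [i hi] : exists i : 'I_(2 ^ n), ~ A i (incr n i w).
    apply/existsNP => h'; apply: h; rewrite inE /= => i ni.
    exact: (h' (Ordinal ni)).
  rewrite [X in _ = (X * _)%:E](bigD1 i)//=.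
  by rewrite indicE memNset// !mul0r.
rewrite expectation_prod//.
- transitivity (\prod_(i < 2 ^ n) P (incr n i @^-1` A' i))%E.
    by apply: eq_bigr => i _; exact: shift.
  rewrite -(incr_independent mA'); congr (P _); apply/seteqP.
  split => w /= h i.
    by move=> ni; exact: (h (Ordinal ni)).
  by move=> _; exact: h.
- by move=> i; exact: mincr.
- move=> i; apply: measurable_funM; first exact: measurable_indic.
  apply: measurableT_comp => //; apply: measurable_funM => //.
  by apply: measurable_funB => //; exact: measurable_funM.
- by move=> i x; rewrite mulr_ge0 ?expR_ge0.
- move=> i; rewrite [X in (X < _)%E](shift i) ltey_eq fin_num_measure//.
  rewrite -[X in measurable X]setTI.
  exact: (mincr (ltn_ord i) measurableT (mA' i)).
Qed.

Local Notation W := (bool * T)%type.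

(* Both processes live on one space, so that a path functional of Z is
   measurable for the sigma-algebra generated by Z simultaneously at B and at
   B + f. *)
Let Z t (z : W) := if z.1 then B t z.2 else B t z.2 + f t.

Let cyl n : set (set W) := [set C | exists2 A : nat -> set R,
  (forall i, measurable (A i)) & C = [set z | forall i, (i < 2 ^ n)%N ->
    A i (Z (tick n i.+1) z - Z (tick n i) z)]].

Let mZ t : 0 <= t <= 1 -> measurable_fun setT (Z t).
Proof.
move=> t01; have mBs : measurable_fun setT (fun z : W => B t z.2).
  exact: measurableT_comp (mB t01) (@measurable_snd _ _ _ _).
apply: measurable_fun_if => //.
- exact: measurable_funTS.
- by apply: measurable_funTS; exact: measurable_funD.
Qed.

Let cyl_incr n (i : nat) (A : set R) : (i < 2 ^ n)%N -> measurable A ->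
  cyl n [set z | A (Z (tick n i.+1) z - Z (tick n i) z)].
Proof.
move=> ni mA; exists (fun j => if j == i then A else setT).
  by move=> j; case: ifP.
apply/seteqP; split => z /= h.
  by move=> j nj; case: eqP => // ->.
by have := h _ ni; rewrite eqxx.
Qed.

Let g_cylS n : <<s cyl n >> `<=` <<s cyl n.+1 >>.
Proof.
apply: smallest_sub; first exact: smallest_sigma_algebra.
move=> _ [A mA ->].
pose S := g_sigma_algebraType (cyl n.+1).
have mi j : (j < 2 ^ n.+1)%N -> measurable_fun (setT : set S)
    (fun z : S => Z (tick n.+1 j.+1) z - Z (tick n.+1 j) z).
  move=> nj _ C mC; rewrite setTI; apply: sub_sigma_algebra.
  exact: cyl_incr.
rewrite (_ : [set _ | _] = \bigcap_(i in `I_(2 ^ n))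
    [set z | A i (Z (tick n i.+1) z - Z (tick n i) z)]); last first.
  by apply/seteqP; split.
apply: (@fin_bigcap_measurable _ S) => // i /= ni.
have n2i : (i.*2.+1 < 2 ^ n.+1)%N by rewrite expnS mul2n -doubleS leq_double.
have := measurable_funD (mi _ n2i) (mi _ (ltnW n2i)).
move=> /(_ measurableT _ (mA i)); rewrite setTI; congr (measurable _).
apply/seteqP; split => z /=; by rewrite -doubleS !tick_double addrA subrK.
Qed.

Let cylI n : setI_closed (cyl n).
Proof.
move=> _ _ [A mA ->] [A' mA' ->]; exists (fun i => A i `&` A' i).
  by move=> i; exact: measurableI.
apply/seteqP; split => z /=.
  by move=> [h h'] i ni; split; [exact: h|exact: h'].
by move=> h; split => i /h [].
Qed.

Let cyl_measurable n : cyl n `<=` measurable.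
Proof.
move=> _ [A mA ->].
rewrite (_ : [set _ | _] = \bigcap_(i in `I_(2 ^ n))
    [set z | A i (Z (tick n i.+1) z - Z (tick n i) z)]); last first.
  by apply/seteqP; split.
apply: fin_bigcap_measurable => // i /= ni.
have h1 : measurable_fun setT (Z (tick n i.+1)).
  by apply: mZ; rewrite tick_ge0 tick_le1.
have h2 : measurable_fun setT (Z (tick n i)).
  by apply: mZ; rewrite tick_ge0 tick_le1// ltnW.
by have := measurable_funB h1 h2 measurableT (mA i); rewrite setTI.
Qed.

Let cylT n : cyl n setT.
Proof. by exists (fun=> setT) => //; apply/seteqP; split. Qed.

Let mpair (b : bool) : measurable_fun setT (fun w : T => (b, w)).
Proof. exact: measurable_fun_pair. Qed.

(** The levels start at 3, where the density formula begins to hold. Their sigma-algebras increase,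
    so the union is closed under intersection. *)
Let path_events : set (set W) := \bigcup_n <<s cyl (n + 3) >>.

(** Uniqueness of measures is used twice: from cylinders to the sigma-algebra of one level, then
    from the union of all levels to the one it generates. *)
Let cylinder_law C : <<s path_events >> C ->
  density P rho [set w | C (true, w)] = P [set w | C (false, w)].
Proof.
have [rhoP rhoPE] : exists m : {measure set T -> \bar R},
  forall A, m A = density P rho A by unshelve eexists (density P rho).
have [m1 m1D] := image_measure rhoP (mpair true).
have [m2 m2D] := image_measure P (mpair false).
have cover : \bigcup_(k : nat) (setT : set W) = setT.
  by apply/seteqP; split => // x _; exists 0%N.
have m1E n C' : cyl (n + 3) C' -> m1 C' = m2 C'.
  move=> [A mA ->]; rewrite m1D m2D rhoPE.
  rewrite /preimage/= [LHS]density_cylinder ?leq_addl//.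
  have E w i : incr (n + 3) i w + drift (n + 3) i =
      Z (tick (n + 3) i.+1) (false, w) - Z (tick (n + 3) i) (false, w).
    by rewrite /incr /drift /Z/=; ring.
  by congr (P _); apply/seteqP; split => w /= h i ni; have := h i ni; rewrite E.
have m1oo : (m1 setT < +oo)%E.
  by rewrite (m1E 0%N)// m2D preimage_setT ltey_eq fin_num_measure ?orbT.
move=> GC; rewrite -rhoPE -[LHS]m1D -[RHS]m2D; move: C GC.
apply: (g_sigma_algebra_measure_unique path_events _ (fun=> setT) _ cover m1 m2).
- move=> A [n _]; apply: smallest_sub; first exact: sigma_algebra_measurable.
  exact: cyl_measurable.
- by move=> _; exists 0%N => //; exact: sub_sigma_algebra.
- have mono n k : <<s cyl (n + 3) >> `<=` <<s cyl (k + n + 3) >>.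
    by elim: k => [//|k IH] A /IH; rewrite !addSn; exact: g_cylS.
  move=> A A' [n _ hA] [n' _ hA']; exists (n' + n)%N => //.
  apply: (@measurableI _ (g_sigma_algebraType (cyl (n' + n + 3)))).
    exact: mono.
  by rewrite [(n' + n)%N]addnC; exact: mono.
- move=> A [n _].
  apply: (g_sigma_algebra_measure_unique (cyl (n + 3)) _ (fun=> setT) _ cover
    m1 m2) => //.
  exact: m1E.
- by [].
Qed.

Let measurable_Z n i : (i <= 2 ^ n)%N ->
  measurable_fun (setT : set (g_sigma_algebraType path_events))
    (Z (i%:R / 2 ^+ n)).
Proof.
(* The same time is rewritten on a grid three levels finer, so that its level is at least 3; the
   value there telescopes into generating increments. *)
rewrite -/(tick n i) -(tick_shift n 3 i) => ni.
have : (i * 2 ^ 3 <= 2 ^ (n + 3))%N by rewrite expnD leq_mul2r ni orbT.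
move: (i * 2 ^ 3)%N => {ni}j; elim: j => [_|j IH nj].
  rewrite (_ : Z _ = cst 0)//; apply/funext => -[b w].
  by rewrite /Z /tick mul0r (sbm_start hB) f0 addr0; case: b.
rewrite (_ : Z _ = (fun z => (Z (tick (n + 3) j.+1) z - Z (tick (n + 3) j) z)
    + Z (tick (n + 3) j) z)); last by apply/funext => z; rewrite subrK.
apply: measurable_funD; last exact: (IH (ltnW nj)).
move=> _ C mC; rewrite setTI; apply: sub_sigma_algebra; exists n => //.
by apply: sub_sigma_algebra; exact: cyl_incr.
Qed.

Let continuous_Z z : {within `[0, 1], continuous (Z^~ z)}.
Proof.
case: z => -[] w; first exact: (sbm_continuous hB).
suff : {within `[0, 1], continuous (B^~ w \+ f)} by [].
have cB := @sbm_continuous _ _ _ _ _ hB w.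
by move=> x; apply: continuousD; [exact: cB|exact: cf].
Qed.

Let Z0 z : Z 0 z = 0.
Proof. by case: z => -[] w; rewrite /Z/= (sbm_start hB) ?f0 ?addr0. Qed.

Lemma cameron_martin_null s t (C D : set R) :
  0 <= s <= 1 -> 0 <= t <= 1 -> measurable C -> measurable D ->
  P [set w | C (vervaat (B^~ w) s) /\ D (vervaat (B^~ w) t)] = 0%E ->
  P [set w | C (vervaat (fun u => B u w + f u) s) /\
             D (vervaat (fun u => B u w + f u) t)] = 0%E.
Proof.
move=> s01 t01 mC mD P0.
have mV u : 0 <= u <= 1 ->
    measurable_fun (setT : set (g_sigma_algebraType path_events))
      (fun z => vervaat (Z^~ z) u).
  exact: measurable_vervaat.
have GE : <<s path_events >>
    [set z | C (vervaat (Z^~ z) s) /\ D (vervaat (Z^~ z) t)].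
  apply: (@measurableI _ (g_sigma_algebraType path_events)).
    by have := mV _ s01 measurableT _ mC; rewrite setTI.
  by have := mV _ t01 measurableT _ mD; rewrite setTI.
have := cylinder_law GE; rewrite /= => <-.
rewrite /density; apply: null_set_integral => //.
- have mVB u : 0 <= u <= 1 -> measurable_fun setT (fun w => vervaat (B^~ w) u).
    move=> u01; apply: measurable_vervaat => //.
    + by move=> n i ni; apply: mB; rewrite tick_ge0 tick_le1.
    + exact: (sbm_continuous hB).
    + exact: (sbm_start hB).
  apply: measurableI.
    by have := mVB _ s01 measurableT _ mC; rewrite setTI.
  by have := mVB _ t01 measurableT _ mD; rewrite setTI.
- by apply/measurable_EFinP; exact: measurable_funTS.
Qed.

End cameron_martin.

(** * Shifts of paths in a tube *)

Section ramp.
Context {R : realType}.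
Implicit Types (t a : R) (k : nat).

Definition ramp k t : R := Num.max 0 (Num.min (8 * t - k%:R) 1).

Lemma ramp_before k t : 8 * t <= k%:R -> ramp k t = 0.
Proof. by move=> h; rewrite /ramp max_l// ge_min subr_le0 h. Qed.

Lemma ramp_after k t : k%:R + 1 <= 8 * t -> ramp k t = 1.
Proof. by move=> h; rewrite /ramp min_r ?max_r//; lra. Qed.

Lemma ramp_during k t : k%:R <= 8 * t <= k%:R + 1 -> ramp k t = 8 * t - k%:R.
Proof. by move=> /andP[h1 h2]; rewrite /ramp min_l ?max_r//; lra. Qed.

Lemma ramp_ge0 k t : 0 <= ramp k t.
Proof. by rewrite le_max lexx. Qed.

Lemma ramp_le1 k t : ramp k t <= 1.
Proof. by rewrite ge_max ler01 ge_min lexx orbT. Qed.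

Lemma continuous_ramp k : continuous (ramp k).
Proof.
move=> t; have -> : ramp k = (cst 0 : R -> R^o) \max
    ((fun t => 8 * t - k%:R : R^o) \min cst 1) by [].
apply: continuous_max; first exact: cvg_cst.
apply: continuous_min; last exact: cvg_cst.
apply: cvgB; last exact: cvg_cst.
by apply: cvgM; [exact: cvg_cst|exact: cvg_id].
Qed.

Lemma dyadic_affine_ramp k : dyadic_affine (ramp k).
Proof.
(* [m] counts the cells of level [n] in an eighth. The kinks of the ramp are grid points, so a cell
   lies entirely before, after or inside the rise. *)
move=> n i n3 _; set m := (2 ^ (n - 3))%N.
have m0 : 0 < m%:R :> R by rewrite ltr0n expn_gt0.
have pE : 2 ^+ n = 8 * m%:R :> R.
  rewrite -[in LHS](subnK n3) exprD /m natrX mulrC; congr (_ * _); ring.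
have tE j : 8 * tick n j = j%:R / m%:R :> R.
  rewrite /tick pE; field; rewrite ?gt_eqF//.
have midE : 8 * tick n.+1 i.*2.+1 = i%:R / m%:R + m%:R^-1 / 2 :> R.
  by rewrite /tick exprS pE -[i.*2.+1]addn1 -mul2n natrD natrM; field; rewrite gt_eqF.
have nextE : i.+1%:R / m%:R = i%:R / m%:R + m%:R^-1 :> R.
  by rewrite -natr1 mulrDl mul1r.
have d0 : 0 < m%:R^-1 :> R by rewrite invr_gt0.
rewrite mulr2n.
have [h|h] := leqP i.+1 (k * m).
  have {}h : i%:R / m%:R + m%:R^-1 <= k%:R :> R.
    by rewrite -nextE ler_pdivrMr// -natrM ler_nat.
  by rewrite !ramp_before ?tE ?midE ?nextE ?addr0//; lra.
have [h'|h'] := leqP (k.+1 * m) i.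
  have {}h' : k%:R + 1 <= i%:R / m%:R :> R.
    by rewrite natr1 ler_pdivlMr// -natrM ler_nat.
  by rewrite !ramp_after ?tE ?midE ?nextE//; lra.
have {}h : k%:R <= i%:R / m%:R :> R.
  by rewrite ler_pdivlMr// -natrM ler_nat.
have {}h' : i%:R / m%:R + m%:R^-1 <= k%:R + 1 :> R.
  by rewrite -nextE natr1 ler_pdivrMr// -natrM ler_nat.
by rewrite !ramp_during ?tE ?midE ?nextE; lra.
Qed.

Lemma ramp_at0 k : ramp k 0 = 0.
Proof. by rewrite ramp_before// mulr0. Qed.

Lemma dyadic_affineD (f g : R -> R) : dyadic_affine f -> dyadic_affine g ->
  dyadic_affine (f \+ g).
Proof.
move=> af ag n i n3 ni; rewrite /= mulrnDl (af _ _ n3 ni) (ag _ _ n3 ni).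
by rewrite addrACA.
Qed.

Lemma dyadic_affineZ a (f : R -> R) : dyadic_affine f ->
  dyadic_affine (fun t => a * f t).
Proof. by move=> af n i n3 ni; rewrite -mulrnAr (af _ _ n3 ni) mulrDr. Qed.

(* Dip by 4M on [0, 1/8], climb to the height theta on [1/4, 3/8], drop by 12M
   on [7/8, 1]: added to a path bounded by M, it puts the argmin in [7/8, 1]
   and makes the transform negative at 1/4. *)
Definition dip_climb_drop (M theta t : R) : R :=
  - (4 * M) * ramp 0 t + (4 * M + theta) * ramp 2 t + - (12 * M) * ramp 7 t.

(* Climb by 2M on [0, 1/8] and by theta on [3/8, 1/2]: added to a path bounded
   by M, it puts the argmin in [0, 1/8] and makes the final value positive. *)
Definition climb_twice (M theta t : R) : R :=
  2 * M * ramp 0 t + theta * ramp 3 t.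

Lemma dip_climb_drop_at0 M theta : dip_climb_drop M theta 0 = 0.
Proof. by rewrite /dip_climb_drop !ramp_at0 !mulr0 !addr0. Qed.

Lemma climb_twice_at0 M theta : climb_twice M theta 0 = 0.
Proof. by rewrite /climb_twice !ramp_at0 !mulr0 !addr0. Qed.

Let continuousZramp a k : continuous (fun t => a * ramp k t).
Proof.
move=> t; apply: cvgM; [exact: cvg_cst|exact: continuous_ramp].
Qed.

Lemma continuous_dip_climb_drop M theta : continuous (dip_climb_drop M theta).
Proof.
move=> t; apply: cvgD; last exact: continuousZramp.
by apply: cvgD; exact: continuousZramp.
Qed.

Lemma continuous_climb_twice M theta : continuous (climb_twice M theta).
Proof. by move=> t; apply: cvgD; exact: continuousZramp. Qed.

Lemma dyadic_affine_dip_climb_drop M theta :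
  dyadic_affine (dip_climb_drop M theta).
Proof.
apply: (dyadic_affineD (f := fun t => _ + _)); last first.
  exact/dyadic_affineZ/dyadic_affine_ramp.
by apply: (dyadic_affineD (f := fun t => _ * _));
  exact/dyadic_affineZ/dyadic_affine_ramp.
Qed.

Lemma dyadic_affine_climb_twice M theta : dyadic_affine (climb_twice M theta).
Proof.
by apply: (dyadic_affineD (f := fun t => _ * _));
  exact/dyadic_affineZ/dyadic_affine_ramp.
Qed.

End ramp.

Section shapes.
Context {R : realType}.
Variables (b : R -> R) (M : R).
Hypotheses (cb : {within `[0, 1], continuous b}) (b0 : b 0 = 0) (M0 : 0 < M).
Hypothesis bM : forall t, 0 <= t <= 1 -> `|b t| <= M.
Implicit Types theta t : R.

Let bM' t : 0 <= t <= 1 -> - M <= b t <= M.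
Proof. by move=> /bM; rewrite ler_norml. Qed.

Let continuous_shift (f : R -> R) : continuous f ->
  {within `[0, 1], continuous (fun t => b t + f t)}.
Proof.
move=> cf; suff : {within `[0, 1], continuous (b \+ f)} by [].
by move=> x; apply: continuousD; [exact: cb|exact: continuous_subspaceT].
Qed.

Section dip_climb_drop.
Let g theta t := b t + dip_climb_drop M theta t.

Let cg theta : {within `[0, 1], continuous (g theta)}.
Proof. exact/continuous_shift/continuous_dip_climb_drop. Qed.

Let g0 theta : g theta 0 = 0.
Proof. by rewrite /g b0 dip_climb_drop_at0 addr0. Qed.

(** Before 7/8 the shifted path is at least -M - 4M, while at 1 it is at most M + 5M - 12M; the
    depth 12M is chosen to beat the dip for every theta up to 5M. *)
Let late_argmin theta t : 0 <= theta <= 5 * M -> 0 <= t <= 1 ->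
  (forall s, 0 <= s <= 1 -> g theta t <= g theta s) -> 7 / 8 <= t <= 1.
Proof.
have M_gt0 := M0.
move=> /andP[th0 thM] /andP[t0 t1] tmin; rewrite t1 andbT leNgt; apply/negP => t78.
have h1 : g theta t <= g theta 1 by apply: tmin; rewrite ler01 lexx.
have /bM'/andP[bt _] : 0 <= t <= 1 by rewrite t0.
have /bM'/andP[_ b1] : 0 <= (1 : R) <= 1 by rewrite ler01 lexx.
have r0 := ramp_le1 0 t; have r2 := ramp_ge0 2 t.
have r7 : ramp 7 t = 0 by rewrite ramp_before//; lra.
have e : g theta 1 = b 1 + theta - 12 * M.
  by rewrite /g /dip_climb_drop !ramp_after; [ring|lra..].
suff : g theta 1 < g theta t by rewrite ltNge h1.
rewrite e /g /dip_climb_drop r7.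
have : M * ramp 0 t <= M by rewrite ler_piMr// ltW.
have : 0 <= (4 * M + theta) * ramp 2 t by rewrite mulr_ge0//; lra.
by lra.
Qed.

Let late_tau theta : 0 <= theta <= 5 * M ->
  7 / 8 <= first_argmin (g theta) <= 1.
Proof.
by move=> th; have [? ? _] := first_argmin_spec (@cg theta); exact: late_argmin th _ _.
Qed.

Let theta0 : 0 <= (0 : R) <= 5 * M.
Proof. by rewrite lexx mulr_ge0// ltW. Qed.

Let same_tau theta : 0 <= theta <= 5 * M ->
  first_argmin (g 0) = first_argmin (g theta).
Proof.
move=> th; apply: (@first_argmin_eq _ _ _ [set t | 7 / 8 <= t <= 1] theta) => //.
- by move=> t t01 tmin; exact: late_argmin theta0 t01 tmin.
- by move=> t t01 tmin; exact: late_argmin th t01 tmin.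
- move=> t /= /andP[t7 t1]; rewrite /g /dip_climb_drop.
  by rewrite (ramp_after (k := 0)) ?(ramp_after (k := 2)); [ring|lra..].
Qed.

(** The time tau - 3/4 falls in [1/8, 1/4], after the dip and before the climb. Theta cancels
    between the values at 1 and tau, the drop contributes at most 0, and the dip of 4M outweighs
    three values of [b]. *)
Lemma vervaat_dip theta : 0 <= theta <= 5 * M ->
  vervaat (fun t => b t + dip_climb_drop M theta t) (1 / 4) < 0.
Proof.
have M_gt0 := M0.
move=> th; rewrite -/(g theta) vervaatE ?g0// /rotate.
have /andP[t7 t1] := late_tau th.
set tau := first_argmin _ in t7 t1 *.
rewrite min_r; last by lra.
rewrite max_l; last by lra.
have /bM'/andP[_ b1] : 0 <= (1 : R) <= 1 by rewrite ler01 lexx.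
have /bM'/andP[bt _] : 0 <= tau <= 1 by lra.
have /bM'/andP[_ bu] : 0 <= tau + 1 / 4 - 1 <= 1 by lra.
have r7 := ramp_le1 7 tau.
have r7M : M * ramp 7 tau <= M by rewrite ler_piMr// ltW.
rewrite /g /dip_climb_drop.
rewrite (ramp_after (t := 1)); last by lra.
rewrite (ramp_after (t := 1)); last by lra.
rewrite (ramp_after (t := 1)); last by lra.
rewrite (ramp_after (k := 0) (t := tau)); last by lra.
rewrite (ramp_after (k := 2) (t := tau)); last by lra.
rewrite (ramp_after (k := 0)); last by lra.
rewrite (ramp_before (k := 2)); last by lra.
rewrite (ramp_before (k := 7)); last by lra.
by lra.
Qed.

(** The time tau - 1/2 falls in [3/8, 1/2], after the climb; of the three values of the path
    involved, those at 1 and tau cancel their theta, and one theta remains. *)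
Let vervaat_dip_halfE theta : 0 <= theta <= 5 * M ->
  vervaat (g theta) (1 / 2) =
  let tau := first_argmin (g theta) in
  b (tau + 1 / 2 - 1) + theta + (b 1 - 12 * M) - (b tau - 12 * M * ramp 7 tau).
Proof.
move=> th; rewrite vervaatE ?g0// /rotate.
have /andP[t7 t1] := late_tau th.
set tau := first_argmin _ in t7 t1 *; rewrite /=.
rewrite min_r; last by lra.
rewrite max_l; last by lra.
rewrite /g /dip_climb_drop.
rewrite (ramp_after (t := 1)); last by lra.
rewrite (ramp_after (t := 1)); last by lra.
rewrite (ramp_after (t := 1)); last by lra.
rewrite (ramp_after (k := 0) (t := tau)); last by lra.
rewrite (ramp_after (k := 2) (t := tau)); last by lra.
rewrite (ramp_after (k := 0)); last by lra.
rewrite (ramp_after (k := 2)); last by lra.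
rewrite (ramp_before (k := 7)); last by lra.
by ring.
Qed.

Lemma vervaat_dip_half theta : 0 <= theta <= 5 * M ->
  vervaat (fun t => b t + dip_climb_drop M theta t) (1 / 2) =
  vervaat (fun t => b t + dip_climb_drop M 0 t) (1 / 2) + theta.
Proof.
move=> th; rewrite -/(g theta) -/(g 0) (vervaat_dip_halfE th).
by rewrite (vervaat_dip_halfE theta0) (same_tau th)/=; ring.
Qed.

(** The lower bound comes from minimality at tau against time 1. It makes this value plus M an
    admissible, nonnegative parameter for [climb_twice]. *)
Lemma vervaat_dip_half_bounds :
  - M <= vervaat (fun t => b t + dip_climb_drop M 0 t) (1 / 2) <= 3 * M.
Proof.
have M_gt0 := M0.
rewrite -/(g 0) (vervaat_dip_halfE theta0)/=.
have /andP[t7 t1] := late_tau theta0.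
have [_ tmin _] := first_argmin_spec (@cg 0).
set tau := first_argmin _ in t7 t1 tmin *.
have h : g 0 tau <= g 0 1 by apply: tmin; rewrite ler01 lexx.
have /bM'/andP[_ b1] : 0 <= (1 : R) <= 1 by rewrite ler01 lexx.
have /bM'/andP[bt _] : 0 <= tau <= 1 by lra.
have /bM'/andP[bl bu] : 0 <= tau + 1 / 2 - 1 <= 1 by lra.
have r7M : M * ramp 7 tau <= M by rewrite ler_piMr ?ramp_le1// ltW.
move: h; rewrite /g /dip_climb_drop.
rewrite (ramp_after (t := 1)); last by lra.
rewrite (ramp_after (t := 1)); last by lra.
rewrite (ramp_after (t := 1)); last by lra.
rewrite (ramp_after (k := 0) (t := tau)); last by lra.
rewrite (ramp_after (k := 2) (t := tau)); last by lra.
by move=> h; apply/andP; split; lra.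
Qed.

End dip_climb_drop.

Section climb_twice.
Let g theta t := b t + climb_twice M theta t.

Let cg theta : {within `[0, 1], continuous (g theta)}.
Proof. exact/continuous_shift/continuous_climb_twice. Qed.

Let g0 theta : g theta 0 = 0.
Proof. by rewrite /g b0 climb_twice_at0 addr0. Qed.

(** After 1/8 the shifted path is at least -M + 2M, above its value 0 at the start. *)
Let early_argmin theta t : 0 <= theta -> 0 <= t <= 1 ->
  (forall s, 0 <= s <= 1 -> g theta t <= g theta s) -> 0 <= t <= 1 / 8.
Proof.
have M_gt0 := M0.
move=> th0 /andP[t0 t1] tmin; rewrite t0/= leNgt; apply/negP => t8.
have h1 : g theta t <= g theta 0 by apply: tmin; rewrite ler01 lexx.
have /bM'/andP[bt _] : 0 <= t <= 1 by rewrite t0.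
suff : g theta 0 < g theta t by rewrite ltNge h1.
rewrite g0 /g /climb_twice (ramp_after (k := 0)); last by lra.
have : 0 <= theta * ramp 3 t by rewrite mulr_ge0// ramp_ge0.
by lra.
Qed.

Let early_tau theta : 0 <= theta -> 0 <= first_argmin (g theta) <= 1 / 8.
Proof.
by move=> th; have [? ? _] := first_argmin_spec (@cg theta); exact: early_argmin th _ _.
Qed.

Let same_tau theta : 0 <= theta -> first_argmin (g 0) = first_argmin (g theta).
Proof.
move=> th; apply: (@first_argmin_eq _ _ _ [set t | 0 <= t <= 1 / 8] 0) => //.
- by move=> t t01 tmin; exact: early_argmin (lexx 0) t01 tmin.
- by move=> t t01 tmin; exact: early_argmin th t01 tmin.
- move=> t /= /andP[t7 t1]; rewrite /g /climb_twice.
  by rewrite (ramp_before (k := 3)); [ring|lra].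
Qed.

Lemma vervaat_climb1 theta : 0 <= theta ->
  0 < vervaat (fun t => b t + climb_twice M theta t) 1.
Proof.
have M_gt0 := M0.
move=> th; rewrite -/(g theta) vervaat1//.
have /bM'/andP[b1 _] : 0 <= (1 : R) <= 1 by rewrite ler01 lexx.
by rewrite /g /climb_twice !ramp_after; lra.
Qed.

(** The time tau + 1/2 falls in [1/2, 5/8], after the second climb, whereas tau precedes it: theta
    enters once. *)
Let vervaat_climb_halfE theta : 0 <= theta ->
  vervaat (g theta) (1 / 2) =
  let tau := first_argmin (g theta) in
  b (tau + 1 / 2) + 2 * M + theta - (b tau + 2 * M * ramp 0 tau).
Proof.
move=> th; rewrite vervaatE ?g0// /rotate.
have /andP[t7 t1] := early_tau th.
set tau := first_argmin _ in t7 t1 *; rewrite /=.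
rewrite min_l; last by lra.
rewrite max_r; last by lra.
rewrite g0 /g /climb_twice.
rewrite (ramp_before (k := 3) (t := tau)); last by lra.
rewrite (ramp_after (k := 0) (t := tau + _)); last by lra.
rewrite (ramp_after (k := 3)); last by lra.
by ring.
Qed.

Lemma vervaat_climb_half theta : 0 <= theta ->
  vervaat (fun t => b t + climb_twice M theta t) (1 / 2) =
  vervaat (fun t => b t + climb_twice M 0 t) (1 / 2) + theta.
Proof.
move=> th; rewrite -/(g theta) -/(g 0) (vervaat_climb_halfE th).
by rewrite (vervaat_climb_halfE (lexx 0)) (same_tau th)/=; ring.
Qed.

(** The upper bound is the origin of the range up to 5M for theta in [dip_climb_drop], whose
    parameter will be this value plus M. *)
Lemma vervaat_climb_half_bounds :
  M <= vervaat (fun t => b t + climb_twice M 0 t) (1 / 2) <= 4 * M.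
Proof.
have M_gt0 := M0.
rewrite -/(g 0) (vervaat_climb_halfE (lexx 0))/=.
have /andP[t7 t1] := early_tau (lexx 0).
have [_ tmin _] := first_argmin_spec (@cg 0).
set tau := first_argmin _ in t7 t1 tmin *.
have h : g 0 tau <= g 0 0 by apply: tmin; rewrite ler01 lexx.
have /bM'/andP[bt _] : 0 <= tau <= 1 by lra.
have /bM'/andP[bl bu] : 0 <= tau + 1 / 2 <= 1 by lra.
have r0 : 0 <= M * ramp 0 tau by rewrite mulr_ge0 ?ramp_ge0// ltW.
move: h; rewrite g0 /g /climb_twice.
by move=> h; apply/andP; split; lra.
Qed.

End climb_twice.
End shapes.

(** * Proof of the theorem *)

Section brownian_tube.
Context d (T : measurableType d) (R : realType) (P : probability T R).
Variable B : R -> T -> R.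
Hypothesis hB : standard_brownian_motion P B.

Definition tube (M : R) : set T :=
  [set w | forall t, 0 <= t <= 1 -> `|B t w| <= M].

Lemma measurable_tube M : measurable (tube M).
Proof.
rewrite (_ : tube M = \bigcap_n \bigcap_(i in `I_(2 ^ n).+1)
    [set w | `|B (tick n i) w| <= M]).
  apply: bigcapT_measurable => n; apply: fin_bigcap_measurable => // i /= ni.
  have mB : measurable_fun setT (fun w => `|B (tick n i) w|).
    apply: measurableT_comp => //; apply: (sbm_measurable hB).
    by rewrite in_itv/= tick_ge0 tick_le1.
  have := measurable_fun_ler mB (measurable_cst M).
  by move=> /(_ measurableT [set true]); rewrite setTI; apply.
apply/seteqP; split => w /=.
  by move=> h n _ i /= ni; apply: h; rewrite tick_ge0 tick_le1.
move=> h t t01.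
have cB := path_cvg_dyadic (f := B^~ w) (@sbm_continuous _ _ _ _ _ hB w) t01.
have cnB : `|B (dyadic_floor n t) w| @[n --> \oo] --> `|B t w|.
  exact: cvg_norm cB.
rewrite -(cvg_lim (@norm_hausdorff _ _) cnB)//.
apply: limr_le; first by apply/cvg_ex; eexists; exact: cnB.
apply: nearW => n; apply: (h n I); rewrite /= ltnS.
exact: truncn_exp2_le.
Qed.

(** Paths are bounded, so the tubes of integer radius exhaust the space and cannot all be null. *)
Lemma tube_gt0 : exists2 M, 0 < M & (0 < P (tube M))%E.
Proof.
apply: contrapT => h.
have P0 n : P.-negligible (tube n.+1%:R).
  apply/(negligibleP P (measurable_tube _)).
  apply/eqP; rewrite eq_le measure_ge0 andbT leNgt; apply/negP => h'.
  by apply: h; exists n.+1%:R.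
have := @negligible_bigcup _ _ _ P (fun n => tube n.+1%:R) P0.
rewrite (_ : \bigcup_n _ = setT); last first.
  rewrite -subTset => w _; have [M hM] := path_bounded (@sbm_continuous _ _ _ _ _ hB w).
  exists (Num.truncn M) => // t t01; apply: le_trans (hM _ t01) _.
  by apply: ltW; exact: truncnS_gt.
move=> /(measure_negligible measurableT) PT0.
have /eqP := etrans (esym PT0) (probability_setT P).
by rewrite eq_sym onee_eq0.
Qed.

End brownian_tube.

(** * Null sets of product measures *)

Section product_null.
Context d1 d2 (T1 : measurableType d1) (T2 : measurableType d2) (R : realType).
Variables (m1 : {sigma_finite_measure set T1 -> \bar R})
          (m2 : {sigma_finite_measure set T2 -> \bar R}).

Lemma null_xsection (S : set (T1 * T2)) :
  (forall x, m2 (xsection S x) = 0%E) -> (m1 \x m2)%E S = 0%E.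
Proof. by move=> S0; rewrite [LHS]integral0_eq// => x _; exact: S0. Qed.

Lemma null_ysection (S : set (T1 * T2)) : measurable S ->
  (forall y, m1 (ysection S y) = 0%E) -> (m1 \x m2)%E S = 0%E.
Proof.
move=> mS S0; rewrite (product_measure_unique (m' := (m1 \x^ m2)%E))//.
  by rewrite [LHS]integral0_eq// => y _; exact: S0.
by move=> A B mA mB; exact: product_measure2E.
Qed.

Lemma null_rectangle (A1 : set T1) (A2 : set T2) (S S' : set (T1 * T2)) :
  measurable A1 -> measurable A2 -> measurable S -> measurable S' ->
  (m1 \x m2)%E S = 0%E -> (m1 \x m2)%E S' = 0%E -> A1 `*` A2 `<=` S `|` S' ->
  (m1 A1 * m2 A2 = 0)%E.
Proof.
move=> mA1 mA2 mS mS' S0 S'0 A12; rewrite -product_measure1E//.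
apply: measure_negligible; first exact: measurableX.
by apply: negligibleS A12 _; apply: negligibleU; exact/negligibleP.
Qed.

End product_null.

Theorem proposition4p1 (R : realType) (d : measure_display)
    (T : measurableType d) (P : probability T R) (B : R -> T -> R) :
  standard_brownian_motion P B ->
  ~ markov_process P (fun t w => vervaat (B^~ w) t).
Proof.
move=> hB markovV.
have cB w : {within `[0, 1], continuous (B^~ w)} by exact: (sbm_continuous hB).
have B0 := sbm_start hB.
have mB t : 0 <= t <= 1 -> measurable_fun setT (B t).
  by move=> t01; apply: (sbm_measurable hB); rewrite in_itv.
have mV (f : R -> R) u : continuous f -> f 0 = 0 -> 0 <= u <= 1 ->
    measurable_fun setT (fun w => vervaat (fun t => B t w + f t) u).
  move=> cf f0 u01; apply: (measurable_vervaat (Z := fun t w => B t w + f t)) => //.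
  - move=> n i ni; apply: measurable_funD => //; apply: mB.
    by rewrite tick_ge0 tick_le1.
  - move=> w; suff : {within `[0, 1], continuous (B^~ w \+ f)} by [].
    by move=> x; apply: continuousD; [exact: cB|exact: continuous_subspaceT].
  - by move=> w; rewrite B0 f0 addr0.
have mVB u : 0 <= u <= 1 -> measurable_fun setT (fun w => vervaat (B^~ w) u).
  move=> u01; apply: measurable_vervaat => //.
  by move=> n i ni; apply: mB; rewrite tick_ge0 tick_le1.
have q01 : 0 <= (1 / 4 : R) <= 1 by lra.
have h01 : 0 <= (1 / 2 : R) <= 1 by lra.
have o01 : 0 <= (1 : R) <= 1 by rewrite ler01 lexx.
pose past := [set w | vervaat (B^~ w) (1 / 4) < 0].
have [D [mD D_final D_past]] : exists D, [/\ measurable D,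
    P ((fun w => vervaat (B^~ w) (1 / 2)) @^-1` D `&`
       (fun w => vervaat (B^~ w) 1) @^-1` `]0, +oo[) = 0%E &
    P (past `&` (fun w => vervaat (B^~ w) (1 / 2)) @^-1` (~` D)) = 0%E].
  apply: (markov_mutually_singular (s := 1 / 2) (t := 1) markovV mVB) => //.
  - by case/andP: h01.
  - apply: sub_sigma_algebra; exists (1 / 4); first by rewrite /= in_itv/=; lra.
    exists `]-oo, 0[%classic; first exact: measurable_itv.
    by rewrite setTI; apply/seteqP; split => w /=; rewrite in_itv.
  - rewrite (_ : past `&` _ = set0); first exact: (measure0 P).
    apply/seteqP; split => // w [/= Vq]; rewrite in_itv/= andbT vervaat1//.
    by have := vervaat_lt0 (@cB w) (B0 w) q01 Vq; lra.
have climb_null M theta : P [set w |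
    D (vervaat (fun t => B t w + climb_twice M theta t) (1 / 2)) /\
    `]0, +oo[%classic (vervaat (fun t => B t w + climb_twice M theta t) 1)] = 0%E.
  apply: (cameron_martin_null hB) => //.
  - exact: climb_twice_at0.
  - by apply: continuous_subspaceT; exact: continuous_climb_twice.
  - exact: dyadic_affine_climb_twice.
have dip_null M theta : P [set w |
    `]-oo, 0[%classic (vervaat (fun t => B t w + dip_climb_drop M theta t) (1 / 4)) /\
    (~` D) (vervaat (fun t => B t w + dip_climb_drop M theta t) (1 / 2))] = 0%E.
  apply: (cameron_martin_null hB) => //.
  - exact: dip_climb_drop_at0.
  - by apply: continuous_subspaceT; exact: continuous_dip_climb_drop.
  - exact: dyadic_affine_dip_climb_drop.
  - exact: measurableC.
have [M M0 PM] := tube_gt0 hB.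
pose E := tube B M.
have mE : measurable E by exact: (measurable_tube hB).
pose X1 w := vervaat (fun t => B t w + dip_climb_drop M 0 t) (1 / 2).
pose X2 w := vervaat (fun t => B t w + climb_twice M 0 t) (1 / 2).
have mX1 : measurable_fun setT X1.
  by apply: mV => //; [exact: continuous_dip_climb_drop|exact: dip_climb_drop_at0].
have mX2 : measurable_fun setT X2.
  by apply: mV => //; [exact: continuous_climb_twice|exact: climb_twice_at0].
have X1E w : E w -> - M <= X1 w <= 3 * M.
  by move=> Ew; exact: vervaat_dip_half_bounds.
have X2E w : E w -> M <= X2 w <= 4 * M.
  by move=> Ew; exact: vervaat_climb_half_bounds.
(* The first path is shifted with theta = X2 + M and the second with theta = X1 + M, so both
   transforms take the value X1 + X2 + M at 1/2. The offset M makes both parameters nonnegative and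
   keeps the former within 5M. *)
pose S (A : set R) := (E `*` E) `&` [set z : T * T | A (X1 z.1 + X2 z.2 + M)].
have mS A : measurable A -> measurable (S A).
  move=> mA; apply: measurableI; first exact: measurableX.
  have mX : measurable_fun setT (fun z : T * T => X1 z.1 + X2 z.2 + M).
    apply: measurable_funD => //; apply: measurable_funD.
      exact: measurableT_comp mX1 (@measurable_fst _ _ _ _).
    exact: measurableT_comp mX2 (@measurable_snd _ _ _ _).
  by have := mX measurableT _ mA; rewrite setTI.
have null_sub (N N' : set T) : measurable N -> measurable N' -> N `<=` N' ->
    P N' = 0%E -> P N = 0%E.
  move=> mN mN' NN' N'0; apply: (@measure_negligible _ _ _ P) => //.
  by apply: negligibleS NN' _; exact/(negligibleP P mN').
(* With the first path frozen, theta = X1 + M is a constant and [climb_null] bounds the section; for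
   the complement of [D] the second path is frozen and [dip_null] is used. *)
have SD : (P \x P)%E (S D) = 0%E.
  apply: (@null_xsection _ _ _ _ _ P P) => w1.
  have [Ew1|nEw1] := pselect (E w1); last first.
    rewrite (_ : xsection _ _ = set0); first exact: (measure0 P).
    apply/seteqP; split => // w2.
    by rewrite /xsection /= inE => -[[]].
  have th : 0 <= X1 w1 + M by have := X1E _ Ew1; lra.
  apply: null_sub (climb_null M (X1 w1 + M)).
  - by apply: measurable_xsection; exact: mS.
  - apply: measurableI.
      have := mV _ _ (@continuous_climb_twice _ M (X1 w1 + M)) (climb_twice_at0 _ _) h01.
      by move=> /(_ measurableT _ mD); rewrite setTI.
    have := mV _ _ (@continuous_climb_twice _ M (X1 w1 + M)) (climb_twice_at0 _ _) o01.
    by move=> /(_ measurableT _ (measurable_itv `]0, +oo[)); rewrite setTI.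
  - move=> w2; rewrite /xsection /= inE => -[[/= _ Ew2] DX].
    rewrite vervaat_climb_half// -/(X2 w2) in_itv/= andbT vervaat_climb1//.
    by split => //; rewrite addrA [X2 _ + _]addrC.
have SDc : (P \x P)%E (S (~` D)) = 0%E.
  apply: (@null_ysection _ _ _ _ _ P P) => [|w2]; first by apply: mS; exact: measurableC.
  have [Ew2|nEw2] := pselect (E w2); last first.
    rewrite (_ : ysection _ _ = set0); first exact: (measure0 P).
    apply/seteqP; split => // w1.
    by rewrite /ysection /= inE => -[[]].
  have th : 0 <= X2 w2 + M <= 5 * M by have := X2E _ Ew2; lra.
  apply: null_sub (dip_null M (X2 w2 + M)).
  - by apply: measurable_ysection; apply: mS; exact: measurableC.
  - apply: measurableI.
      have := mV _ _ (@continuous_dip_climb_drop _ M (X2 w2 + M))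
        (dip_climb_drop_at0 _ _) q01.
      by move=> /(_ measurableT _ (measurable_itv `]-oo, 0[)); rewrite setTI.
    have := mV _ _ (@continuous_dip_climb_drop _ M (X2 w2 + M))
      (dip_climb_drop_at0 _ _) h01.
    by move=> /(_ measurableT _ (measurableC mD)); rewrite setTI.
  - move=> w1; rewrite /ysection /= inE => -[[/= Ew1 _] DX].
    rewrite vervaat_dip_half// -/(X1 w1) in_itv/= vervaat_dip//.
    by split => //; rewrite addrA.
have /eqP : (P E * P E = 0)%E.
  apply: (@null_rectangle _ _ _ _ _ P P _ _ (S D) (S (~` D))) => //.
  - exact: mS.
  - by apply: mS; exact: measurableC.
  - move=> z Ez.
    by have [h|h] := pselect (D (X1 z.1 + X2 z.2 + M)); [left|right].
by rewrite mule_eq0 orbb => /eqP PE; move: PM; rewrite -/E PE ltxx.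
Qed.
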